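(* Let $m\ge2$ be an integer. For $n\in\mathbb{N}$ let $\nu=(1^n)$ if $m$ is even and $\nu=(n)$ if $m$ is odd. For every $n\in\mathbb{N}$, the multiplicity of the Specht module labelled by the lexicographically minimal constituent of $H_{(m-1,1)}^{\nu}$ (that is, by the lexicographically least partition $\lambda$ such that $S^\lambda$ is a summand of $H_{(m-1,1)}^{\nu}$) is equal to $\binom{m-1}{e}$ for some $e\in\{1,\ldots,m-1\}$. Moreover, all these values are attained: for each $e\in\{1,\ldots,m-1\}$ there is some $n\in\mathbb{N}$ for which this multiplicity equals $\binom{m-1}{e}$.
   Context: $\mathbb{N}=\{1,2,\ldots\}$. $S^\lambda$ is the Specht module over $\mathbb{Q}$ labelled by the partition $\lambda$ (irreducible, with $S^{(r)}$ the trivial $\mathbb{Q}S_r$-module). The wreath product $S_m\wr S_n$ acts as a transitive imprimitive subgroup of $S_{mn}$. For a $\mathbb{Q}S_m$-module $W$ and a $\mathbb{Q}S_n$-module $Z$, $W\oslash Z$ is the $\mathbb{Q}(S_m\wr S_n)$-module $W^{\otimes n}\otimes Z$, where $S_m^n$ acts factorwise on $W^{\otimes n}$ and trivially on $Z$, and $S_n$ acts by permuting the tensor factors of $W^{\otimes n}$ (no signs) and by its given action on $Z$. For $\mu$ a partition of $m$ and $\nu$ a partition of $n$, the generalized Foulkes module is $H_\mu^\nu=(S^\mu\oslash S^\nu)\uparrow_{S_m\wr S_n}^{S_{mn}}$. *)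

(* Defs.v *)
From HB Require Import structures.
From mathcomp Require Import all_boot all_order all_algebra all_fingroup.
From mathcomp Require Import all_solvable all_field all_character.

Set Implicit Arguments.
Unset Strict Implicit.
Unset Printing Implicit Defensive.

Import Order.TTheory GRing.Theory GroupScope.
Local Open Scope ring_scope.

Definition is_partition (n : nat) (la : seq nat) : bool :=
  [&& sorted geq la, 0%N \notin la & sumn la == n].

(* Modules are right modules throughout: permutations compose from left to    *)
(* right, and matrices of representations act on row vectors.                 *)

Section Specht.

Variables (F : fieldType) (n : nat) (la : seq nat).

(* The boxes of the Young diagram are numbered row by row, box b lying in row *)
(* reshape_index la b and column reshape_offset la b; the permutation t is    *)
(* the tableau whose box b contains t b. Thus t * p is the tableau obtained   *)
(* from t by applying p to its entries.                                       *)
Definition row_of (t : 'S_n) (k : 'I_n) : nat := reshape_index la (t^-1%g k).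
Definition col_of (t : 'S_n) (k : 'I_n) : nat := reshape_offset la (t^-1%g k).

Definition tabloid (t : 'S_n) : {set 'S_n} :=
  [set u : 'S_n | [forall k, row_of u k == row_of t k]].

Definition tabloids : {set {set 'S_n}} := [set tabloid t | t : 'S_n].

Definition col_stab (t : 'S_n) : {set 'S_n} :=
  [set p : 'S_n | [forall k, col_of t (p k) == col_of t k]].

Definition tabloid_mx (p : 'S_n) : 'M[F]_#|tabloids| :=
  \matrix_(i, j) (enum_val i :* p == enum_val j)%:R.

Definition tabloid_vec (A : {set 'S_n}) : 'rV[F]_#|tabloids| :=
  \row_j (A == enum_val j)%:R.

Definition polytabloid (t : 'S_n) : 'rV[F]_#|tabloids| :=
  \sum_(p in col_stab t) (-1) ^+ p *: tabloid_vec (tabloid (t * p)%g).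

Lemma row_ofM t p k : row_of (t * p)%g k = row_of t (p^-1%g k).
Proof. by rewrite /row_of invMg permM. Qed.

Lemma col_ofM t p k : col_of (t * p)%g k = col_of t (p^-1%g k).
Proof. by rewrite /col_of invMg permM. Qed.

Lemma tabloidM t p : tabloid (t * p)%g = tabloid t :* p.
Proof.
apply/setP => u; rewrite mem_rcoset !inE; apply/forallP/forallP => h k.
  by have := h (p k); rewrite !row_ofM invgK permK.
by have := h (p^-1%g k); rewrite !row_ofM invgK permKV.
Qed.

Lemma tabloid_in t : tabloid t \in tabloids.
Proof. exact: imset_f. Qed.

Lemma tabloids_rcoset A p : A \in tabloids -> A :* p \in tabloids.
Proof. by case/imsetP => t _ ->; rewrite -tabloidM tabloid_in. Qed.

Lemma tabloid_vecM A p :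
  A \in tabloids -> tabloid_vec A *m tabloid_mx p = tabloid_vec (A :* p).
Proof.
move=> TA; apply/rowP => j; rewrite !mxE.
rewrite (bigD1 (enum_rank_in TA A)) //= !mxE enum_rankK_in // eqxx mul1r.
rewrite big1 ?addr0 // => i neq; rewrite !mxE; case: eqP => [eA|]; last first.
  by rewrite mul0r.
by case/eqP: neq; apply: enum_val_inj; rewrite enum_rankK_in.
Qed.

Lemma row_tabloid_mx i p : row i (tabloid_mx p) = tabloid_vec (enum_val i :* p).
Proof. by apply/rowP => j; rewrite !mxE. Qed.

Lemma tabloid_mx_repr : mx_repr [set: 'S_n] tabloid_mx.
Proof.
split=> [|p q _ _]; first by apply/matrixP => i j;
  rewrite !mxE rcoset1 (inj_eq enum_val_inj).
apply/row_matrixP => i; rewrite row_mul !row_tabloid_mx.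
by rewrite tabloid_vecM ?tabloids_rcoset ?enum_valP // rcosetM.
Qed.

Canonical tabloid_repr := MxRepresentation tabloid_mx_repr.

Definition specht_mx : 'M[F]_#|tabloids| :=
  (\sum_(t : 'S_n) <<polytabloid t>>)%MS.

Lemma polytabloidM t p :
  polytabloid t *m tabloid_mx p = polytabloid (t * p)%g.
Proof.
rewrite /polytabloid mulmx_suml.
rewrite [RHS](reindex_inj (@conjg_inj _ p)) /=; apply: eq_big => [q|q _].
  rewrite !inE; apply/forallP/forallP => h k.
    by have := h (p^-1%g k); rewrite !col_ofM conjgE !permM permK.
  by have := h (p k); rewrite !col_ofM conjgE !permM !permK.
rewrite -scalemxAl odd_permJ tabloid_vecM ?tabloid_in // -tabloidM.
by rewrite conjgE !mulgA mulgK.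
Qed.

Lemma specht_module : mxmodule tabloid_repr specht_mx.
Proof.
apply/mxmoduleP => p _; rewrite /specht_mx sumsmxMr; apply/sumsmx_subP => t _.
rewrite (eqmxMr _ (genmxE _)) /= polytabloidM.
by rewrite (sumsmx_sup (t * p)%g) // genmxE.
Qed.

Definition specht : representation F [set: 'S_n] :=
  Representation (submod_repr specht_module).

End Specht.

Lemma insubd_permE (T : finType) (u : {perm T}) (f : {ffun T -> T}) :
  injectiveb f -> insubd u f =1 f.
Proof.
by move=> f_inj x; rewrite -pvalE; have /= -> := insubdK u f_inj.
Qed.

Section Wreath.

Variables (m n : nat).

(* The m * n letters are indexed by pairs: mxvec_index j i is the j-th letter *)
(* of the i-th block, where j : 'I_m and i : 'I_n.                            *)
Definition unletter (k : 'I_(m * n)) : 'I_m * 'I_n :=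
  enum_val (cast_ord (esym (mxvec_cast m n)) k).
Definition letter_pos (k : 'I_(m * n)) : 'I_m := (unletter k).1.
Definition letter_block (k : 'I_(m * n)) : 'I_n := (unletter k).2.

Definition wreath_set : {set 'S_(m * n)} :=
  [set g : 'S_(m * n) | [forall k, forall l,
    (letter_block (g k) == letter_block (g l))
      == (letter_block k == letter_block l)]].

(* For g in the wreath product, g sends the j-th letter of block i to the     *)
(* (wreath_factor g i j)-th letter of block (wreath_top g i). (The functions  *)
(* below are then injective, so the default 1 of insubd is not used, and the  *)
(* default i of oapp is used only if m = 0.)                                  *)
Definition wreath_top (g : 'S_(m * n)) : 'S_n :=
  insubd (1%g : 'S_n) [ffun i : 'I_n =>
    oapp (fun j : 'I_m => letter_block (g (mxvec_index j i))) i [pick j : 'I_m]].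

Definition wreath_factor (g : 'S_(m * n)) (i : 'I_n) : 'S_m :=
  insubd (1%g : 'S_m) [ffun j : 'I_m => letter_pos (g (mxvec_index j i))].

Lemma unletterK j i : unletter (mxvec_index j i) = (j, i).
Proof. by rewrite /unletter /mxvec_index cast_ordK enum_rankK. Qed.

Lemma letterE k : mxvec_index (letter_pos k) (letter_block k) = k.
Proof.
by case/mxvec_indexP: k => j i; rewrite /letter_pos /letter_block unletterK.
Qed.

Lemma letter_blockE j i : letter_block (mxvec_index j i) = i.
Proof. by rewrite /letter_block unletterK. Qed.

Lemma letter_posE j i : letter_pos (mxvec_index j i) = j.
Proof. by rewrite /letter_pos unletterK. Qed.

Lemma wreath_setP (g : 'S_(m * n)) : reflect
  (forall k l, (letter_block (g k) == letter_block (g l))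
     = (letter_block k == letter_block l)) (g \in wreath_set).
Proof.
by rewrite inE; apply: (iffP forallP) => h k;
  [move=> l; have /forallP/(_ l)/eqP := h k | apply/forallP => l; apply/eqP].
Qed.

Lemma wreath_group_set : group_set wreath_set.
Proof.
apply/group_setP; split=> [|g h /wreath_setP hg /wreath_setP hh].
  by apply/wreath_setP => k l; rewrite !perm1.
by apply/wreath_setP => k l; rewrite !permM hh hg.
Qed.

Canonical wreath : {group 'S_(m * n)} := Group wreath_group_set.

Lemma wreath_topE (g : 'S_(m * n)) j i : g \in wreath ->
  letter_block (g (mxvec_index j i)) = wreath_top g i.
Proof.
move=> /wreath_setP hg; rewrite /wreath_top.
set f := (X in insubd _ X).
have fE j' i' : f i' = letter_block (g (mxvec_index j' i')).
  rewrite ffunE; case: pickP => [j1 _|/(_ j')//] /=.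
  by apply/eqP; rewrite hg !letter_blockE.
have f_inj : injectiveb f.
  apply/injectiveP => i1 i2; rewrite !(fE j) => /eqP.
  by rewrite hg !letter_blockE => /eqP.
by rewrite insubd_permE // fE.
Qed.

Lemma wreath_factorE (g : 'S_(m * n)) j i : g \in wreath ->
  letter_pos (g (mxvec_index j i)) = wreath_factor g i j.
Proof.
move=> Wg; rewrite /wreath_factor.
set f := (X in insubd _ X).
have f_inj : injectiveb f.
  apply/injectiveP => j1 j2; rewrite !ffunE => e.
  have : g (mxvec_index j1 i) = g (mxvec_index j2 i).
    by rewrite -[LHS]letterE -[RHS]letterE e !wreath_topE.
  by move/perm_inj/(congr1 letter_pos); rewrite !letter_posE.
by rewrite insubd_permE // ffunE.
Qed.

Lemma wreathE (g : 'S_(m * n)) j i : g \in wreath ->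
  g (mxvec_index j i) = mxvec_index (wreath_factor g i j) (wreath_top g i).
Proof.
by move=> Wg; rewrite -wreath_factorE // -(wreath_topE j) // letterE.
Qed.

Lemma wreath_topM g h : g \in wreath -> h \in wreath ->
  wreath_top (g * h)%g = (wreath_top g * wreath_top h)%g.
Proof.
move=> Wg Wh; apply/permP => i; rewrite permM.
case: (pickP (fun _ : 'I_m => true)) => [j _|no].
  rewrite -(wreath_topE j) ?groupM // permM wreathE //.
  by rewrite wreath_topE.
have top_id u k : wreath_top u k = k.
  have fE : [ffun i : 'I_n =>
      oapp (fun j : 'I_m => letter_block (u (mxvec_index j i))) i
        [pick j : 'I_m]] = pval (1%g : 'S_n).
    apply/ffunP => i'; rewrite ffunE pvalE perm1.
    by case: pickP => // j; have := no j.
  by rewrite /wreath_top fE valKd perm1.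
by rewrite !top_id.
Qed.

Lemma wreath_top1 : wreath_top 1%g = 1%g.
Proof.
have := @wreath_topM 1%g 1%g (group1 _) (group1 _).
rewrite mulg1 => e; apply: (mulgI (wreath_top 1%g)).
by rewrite mulg1 -[LHS]e.
Qed.

Lemma wreath_factorM g h i : g \in wreath -> h \in wreath ->
  wreath_factor (g * h)%g i
    = (wreath_factor g i * wreath_factor h (wreath_top g i))%g.
Proof.
move=> Wg Wh; apply/permP => j.
rewrite permM -wreath_factorE ?groupM // permM wreathE //.
by rewrite wreath_factorE.
Qed.

Lemma wreath_factor1 i : wreath_factor 1%g i = 1%g.
Proof.
by apply/permP => j; rewrite -wreath_factorE ?group1 // !perm1 letter_posE.
Qed.

Section Oslash.

Variable F : fieldType.
Variables (W : representation F [set: 'S_m]) (Z : representation F [set: 'S_n]).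

(* The basis of the n-th tensor power of W is indexed by functions f, which   *)
(* stand for e_(f 0) (x) ... (x) e_(f n.-1); g applies wreath_factor g i to   *)
(* the i-th factor and moves it to position wreath_top g i.                   *)
Definition tensor_pow_mx (g : 'S_(m * n)) :
    'M[F]_#|{ffun 'I_n -> 'I_(rdegree W)}| :=
  \matrix_(a, b) \prod_(i < n)
    W (wreath_factor g i) ((enum_val a : {ffun _ -> _}) i)
      ((enum_val b : {ffun _ -> _}) (wreath_top g i)).

Lemma tensor_pow_mx_repr : mx_repr wreath tensor_pow_mx.
Proof.
pose ev (a : 'I_#|{ffun 'I_n -> 'I_(rdegree W)}|) :
  {ffun 'I_n -> 'I_(rdegree W)} := enum_val a.
split=> [|g h Wg Wh]; apply/matrixP => a b; rewrite !mxE.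
  rewrite wreath_top1.
  under eq_bigr do rewrite wreath_factor1 repr_mx1 perm1 mxE.
  case: (eqVneq a b) => [-> | neq].
    by rewrite big1 // => i _; rewrite eqxx.
  case: (pickP (fun i => ev a i != ev b i)) => [i hi|all_eq].
    by rewrite (bigD1 i) //= (negPf hi) mul0r.
  case/eqP: neq; apply: enum_val_inj; apply/ffunP => i.
  by apply/eqP; have /negbFE := all_eq i.
set s := wreath_top g.
transitivity (\prod_(i < n) \sum_(x < rdegree W)
    W (wreath_factor g i) (ev a i) x
    * W (wreath_factor h (s i)) x (ev b (wreath_top h (s i)))).
  apply: eq_bigr => i _.
  by rewrite wreath_factorM // wreath_topM // repr_mxM ?inE // mxE permM.
rewrite bigA_distr_bigA /=.
rewrite (reindex (fun c : {ffun 'I_n -> 'I_(rdegree W)} =>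
  [ffun i => c (s i)])) /=; last first.
  exists (fun c => [ffun i => c (s^-1%g i)]) => c _; apply/ffunP => i.
    by rewrite !ffunE permKV.
  by rewrite !ffunE permK.
rewrite (reindex (@enum_val _ {ffun 'I_n -> 'I_(rdegree W)})) /=; last first.
  exact/onW_bij/enum_val_bij.
apply: eq_bigr => c _; rewrite !mxE big_split /=; congr (_ * _).
  by apply: eq_bigr => i _; rewrite ffunE.
rewrite [RHS](reindex_inj (@perm_inj _ s)) /=.
by apply: eq_bigr => i _; rewrite ffunE.
Qed.

Definition tensor_pow_repr := MxRepresentation tensor_pow_mx_repr.

Lemma wreath_inflate_mx_repr : mx_repr wreath (fun g => Z (wreath_top g)).
Proof.
split=> [|g h Wg Wh]; first by rewrite wreath_top1 repr_mx1.
by rewrite wreath_topM // repr_mxM ?inE.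
Qed.

Definition wreath_inflate_repr := MxRepresentation wreath_inflate_mx_repr.

Definition oslash : representation F wreath :=
  Representation (prod_repr tensor_pow_repr wreath_inflate_repr).

End Oslash.

End Wreath.

Section Induction.

Variables (F : fieldType) (gT : finGroupType) (G H : {group gT}).
Hypothesis sHG : H \subset G.
Variable W : representation F H.

(* With t_i running over representatives of the right cosets of H in G, the   *)
(* induced module is the direct sum of the W (x) t_i, and                     *)
(* (w (x) t_i) g = w h (x) t_j when t_i g = h t_j with h in H.                *)
Definition rcoset_rep (i : 'I_#|rcosets H G|) : gT := repr (enum_val i).

Definition induced_mx (g : gT) :
    'M[F]_(\sum_(i < #|rcosets H G|) rdegree W) :=
  \mxblock_(i, j)
    let h := (rcoset_rep i * g * (rcoset_rep j)^-1)%g in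
    if h \in H then W h else 0.

Lemma rcoset_repP i : rcoset_rep i \in G /\ enum_val i = H :* rcoset_rep i.
Proof.
case/rcosetsP: (enum_valP i) => x Gx e.
have e' : enum_val i = H :* rcoset_rep i.
  by rewrite /rcoset_rep e rcoset_repr.
have : rcoset_rep i \in H :* x by rewrite -e e' rcoset_refl.
case/rcosetP => h Hh ->; split; last first.
  by rewrite e rcosetM (rcoset_id Hh).
by rewrite groupM // (subsetP sHG).
Qed.

Lemma rcoset_rep_ex x : x \in G ->
  exists2 k, (x * (rcoset_rep k)^-1)%g \in H
    & forall k', (x * (rcoset_rep k')^-1)%g \in H -> k' = k.
Proof.
move=> Gx; have RHx : H :* x \in rcosets H G by apply/rcosetsP; exists x.
have inH k : ((x * (rcoset_rep k)^-1)%g \in H) = (H :* x == enum_val k).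
  have [_ ->] := rcoset_repP k; rewrite -mem_rcoset.
  by apply/idP/eqP => [/rcoset_eqP //|<-]; rewrite rcoset_refl.
exists (enum_rank_in RHx (H :* x)).
  by rewrite inH enum_rankK_in.
move=> k; rewrite inH => /eqP e; apply: enum_val_inj.
by rewrite enum_rankK_in.
Qed.

Lemma induced_mx_repr : mx_repr G induced_mx.
Proof.
have inG i : rcoset_rep i \in G by case: (rcoset_repP i).
split=> [|x y Gx Gy].
  rewrite -mxdiagZ; apply: eq_mxblock => i j /=.
  have [k _ uk] := rcoset_rep_ex (inG i).
  rewrite mulg1; have [<-|neq] := eqVneq i j.
    by rewrite mulgV group1 repr_mx1 conform_mx_id.
  case: ifP => [hj|//].
  by case/eqP: neq; rewrite (uk j hj) (uk i) // mulgV.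
rewrite mul_mxblock; apply: eq_mxblock => i j /=.
have [k hk uk] := rcoset_rep_ex (groupM (inG i) Gx).
rewrite (bigD1 k) //= hk big1 ?addr0 => [|k' neq]; last first.
  by case: ifP => [/uk e|]; rewrite ?mul0mx //; case/eqP: neq.
set h := (_ * x * _)%g in hk *.
have -> : (rcoset_rep i * (x * y) * (rcoset_rep j)^-1
  = h * (rcoset_rep k * y * (rcoset_rep j)^-1))%g.
  by rewrite /h !mulgA mulgKV.
rewrite groupMl //; case: ifP => [h'|_]; last by rewrite mulmx0.
exact: repr_mxM.
Qed.

Definition induced : representation F G :=
  Representation (MxRepresentation induced_mx_repr).

End Induction.

Section Multiplicity.

Variables (F : fieldType) (gT : finGroupType) (G : {group gT}).

Definition is_summand (S V : representation F G) : Prop :=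
  exists M : representation F G, mx_rsim V (dadd_grepr S M).

(* V is isomorphic to S^k (+) M where S is not a summand of M. For V semisimple  *)
(* and S irreducible, there is exactly one such k, the multiplicity of S in V. *)
Definition has_multiplicity (S V : representation F G) (k : nat) : Prop :=
  exists2 M : representation F G,
    mx_rsim V (dadd_grepr (muln_grepr S k) M) & ~ is_summand S M.

End Multiplicity.

Definition foulkes (F : fieldType) (m n : nat) (mu nu : seq nat) :
    representation F [set: 'S_(m * n)] :=
  induced (subsetT (wreath m n)) (oslash (specht F m mu) (specht F n nu)).

Definition is_lex_min_constituent (F : fieldType) (N : nat)
    (V : representation F [set: 'S_N]) (la : seq nat) : Prop :=
  [/\ is_partition N la, is_summand (specht F N la) V
    & forall ka, is_partition N ka -> is_summand (specht F N ka) V ->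
        ((la : seqlexi nat) <= (ka : seqlexi nat))%O].

(* Main.v *)
(* For a colouring c of the letters, let beta_c be the signed sum of the      *)
(* permutations preserving c. If c colours the letters of a tableau of shape  *)
(* la by columns, then beta_c has rank 1 on S^la and kills S^ka unless        *)
(* ka <= la lexicographically. Hence the least la such that beta_c does not   *)
(* kill a module is its lexicographically minimal constituent, and the rank   *)
(* of beta_c is its multiplicity.                                             *)
(*   On the Foulkes module these ranks are computed by traces. The parity     *)
(* condition on nu says that twisting by the sign of S_{mn} turns the module  *)
(* into an exterior power: the rank of beta_c is the number of n-subsets of   *)
(* total weight wt(c) in a graded basis of the S_m-invariants of the words of *)
(* length m tensored with S^(m-1,1) (x) sgn. Such a basis has m-1 elements of *)
(* each weight without a repeated colour, and at most one of any other        *)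
(* weight. Lexicographic minimality asks for the n lightest basis elements:   *)
(* all elements below some weight v and e elements of weight v. This leaves   *)
(* binom(m-1, e) or binom(1, 1) = binom(m-1, m-1) choices, and every e occurs *)
(* for the weight v in which each of the first m colours is used once.        *)

Require Import Defs.
From HB Require Import structures.
From mathcomp Require Import all_boot all_order all_algebra all_fingroup.
From mathcomp Require Import all_solvable all_field all_character.
From Stdlib Require Import Classical.
From mathcomp Require Import zify.

Set Implicit Arguments.
Unset Strict Implicit.
Unset Printing Implicit Defensive.

Import Order.TTheory GRing.Theory Num.Theory GroupScope.
Local Open Scope ring_scope.

(** * Signed sums over stabilizers of colourings *)

(** For a group [A] of permutations the signed sum [asum] over [A] is [#|A|] times an idempotent, so
    its rank is its trace divided by [#|A|] ([mxtrace_asum]). Constituents are detected by column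
    antisymmetrizers: the one of shape [la] has rank 1 on the Specht module of [la]
    ([rank_asum_specht]) and kills that of [ka] unless [ka] is lexicographically at most [la]
    ([lexi_of_asum_specht]). Since every irreducible module is a Specht module ([irr_specht]), the
    least [la] whose antisymmetrizer does not kill a module labels its minimal constituent, and the
    rank of this antisymmetrizer is the multiplicity ([lex_min_multiplicity]).

    A column stabilizer is the stabilizer [cstab] of the colouring of the letters by columns. For
    any colouring, the formula for induced characters and the summation over the wreath product
    express the rank on the Foulkes module as an alternating sum over S_n of products of entries of
    one projection P ([rank_asum_foulkes]). Here P projects (words of length m) (x) S^(m-1,1) (x)
    sgn onto its S_m-invariants. A block permutation s has sign sgn(s)^m on the letters, and nu is
    chosen so that together with the character of S^nu this gives sgn(s). So the sum is a trace on
    the n-th exterior power of the image of P, and the rank counts the n-subsets of a weighted basis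
    of this image whose total weight is that of the colouring ([rank_asum_foulkes_count]).

    In the weight of a word the basis has as many elements as the rank, on S^(m-1,1), of the signed
    sum over the stabilizer of the word ([rank_graded_word]): m-1 if the colours are distinct, at
    most 1 otherwise. The weights of column colourings order partitions lexicographically
    ([lexi_of_part_weight]), so the minimal constituent belongs to the lightest n-subsets. These
    consist of all basis elements lighter than some v and any e elements of weight v
    ([card_min_weight], [foulkes_lex_min]), which leaves binom(m-1,e) or binom(1,1) = binom(m-1,m-1)
    choices. Taking v to be the weight of a word with m distinct colours, and n accordingly,
    realizes every e. *)

Lemma mxtrace_idempotent (K : fieldType) k (P : 'M[K]_k) :
  P *m P = P -> \tr P = (\rank P)%:R.
Proof.
move=> PP; move: (col_base_full P) (row_base_free P) (mulmx_base P).
move: (col_base P) (row_base P) => C R fC fR eP.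
rewrite -[P in \tr P]eP mxtrace_mulC; suff -> : R *m C = 1%:M.
  by rewrite mxtrace1.
apply: (row_full_inj fC); apply: (row_free_inj fR).
by rewrite mulmx1 mulmxA eP -mulmxA eP PP.
Qed.


Section SignedSum.

Variables (F : numFieldType) (N : nat).

Definition cstab (D : eqType) (c : 'I_N -> D) : {set 'S_N} :=
  [set p : 'S_N | [forall k, c (p k) == c k]].

Lemma cstabP (D : eqType) (c : 'I_N -> D) (p : 'S_N) :
  reflect (forall k, c (p k) = c k) (p \in cstab c).
Proof. by rewrite inE; apply: (iffP forallP) => h k; apply/eqP. Qed.

Lemma cstab_group_set (D : eqType) (c : 'I_N -> D) : group_set (cstab c).
Proof.
apply/group_setP; split=> [|p q /cstabP hp /cstabP hq].
  by apply/cstabP => k; rewrite perm1.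
by apply/cstabP => k; rewrite permM hq hp.
Qed.

Canonical cstab_group (D : eqType) (c : 'I_N -> D) :=
  Group (cstab_group_set c).

Section OneRepresentation.

Variables (n : nat) (rG : mx_representation F [set: 'S_N] n).

Definition asum (A : {set 'S_N}) : 'M[F]_n :=
  \sum_(p in A) (-1) ^+ p *: rG p.

Lemma asumMl (A : {group 'S_N}) p : p \in A ->
  rG p *m asum A = (-1) ^+ p *: asum A.
Proof.
move=> Ap; rewrite /asum mulmx_sumr scaler_sumr.
rewrite (reindex_inj (mulgI p^-1%g)) /=; apply: eq_big => q.
  by rewrite groupMl ?groupV.
move=> _; rewrite -scalemxAr -repr_mxM ?inE // mulKVg scalerA.
by rewrite odd_permM odd_permV signr_addb.
Qed.

Lemma asumM (A : {group 'S_N}) : asum A *m asum A = #|A|%:R *: asum A.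
Proof.
rewrite {1}/asum mulmx_suml scaler_nat -sumr_const.
apply: eq_bigr => p Ap; rewrite -scalemxAl asumMl // scalerA.
by rewrite -signr_addb addbb scale1r.
Qed.

(** In characteristic 0 this determines the rank of a signed sum from character values. *)
Lemma mxtrace_asum (A : {group 'S_N}) :
  \tr (asum A) = #|A|%:R * (\rank (asum A))%:R.
Proof.
have nzA : (#|A|%:R : F) != 0 by rewrite pnatr_eq0 -lt0n cardG_gt0.
set P := #|A|%:R^-1 *: asum A.
have eA : asum A = #|A|%:R *: P by rewrite scalerA divff // scale1r.
have PP : P *m P = P.
  rewrite -scalemxAl -scalemxAr asumM !scalerA.
  by rewrite divfK.
rewrite eA mxtraceZ mxtrace_idempotent //.
by rewrite (eqmx_scale P nzA).
Qed.

End OneRepresentation.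

Lemma rank_asum_rsim n1 (rG1 : mx_representation F [set: 'S_N] n1)
    n2 (rG2 : mx_representation F [set: 'S_N] n2) (A : {set 'S_N}) :
  mx_rsim rG1 rG2 -> \rank (asum rG1 A) = \rank (asum rG2 A).
Proof.
move=> sim; have e := mxrank_rsim sim; case: n2 / e rG2 sim => rG2.
case=> B _; rewrite row_free_unit => uB hom.
have eB : asum rG1 A *m B = B *m asum rG2 A.
  rewrite /asum mulmx_suml mulmx_sumr; apply: eq_bigr => p _.
  by rewrite -scalemxAl -scalemxAr hom // inE.
by rewrite -(mxrankMfree _ (etrans (row_free_unit _) uB)) eB
   (eqmxMfull _ (etrans (row_full_unit _) uB)).
Qed.

Implicit Types V W : representation F [set: 'S_N].

Lemma rank_asum_dadd V W (A : {set 'S_N}) :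
  \rank (asum (dadd_grepr V W) A) = (\rank (asum V A) + \rank (asum W A))%N.
Proof.
suff -> : asum (dadd_grepr V W) A = block_mx (asum V A) 0 0 (asum W A).
  exact: rank_diag_block_mx.
rewrite /asum; elim/big_rec3: _ => [|p x y z Ap ->]; first by rewrite block_mx0.
by rewrite /= scale_block_mx add_block_mx !scaler0 !addr0.
Qed.

Lemma rank_asum_muln V k (A : {set 'S_N}) :
  \rank (asum (muln_grepr V k) A) = (k * \rank (asum V A))%N.
Proof.
rewrite /muln_grepr; elim: k => [|k IHk].
  by rewrite big_ord0 mul0n; apply/eqP; rewrite -leqn0 rank_leq_row.
by rewrite big_ord_recl rank_asum_dadd IHk mulSn.
Qed.

End SignedSum.

(** * Specht modules *)

Section Tableaux.

Local Open Scope nat_scope.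

Variables (N : nat) (la : seq nat).
Hypothesis la_part : is_partition N la.

Lemma sumn_part : sumn la = N.
Proof. by case/and3P: la_part => _ _ /eqP. Qed.

Lemma nth_part_leq i j : i <= j -> nth 0 la j <= nth 0 la i.
Proof.
case/and3P: la_part => s _ _ ij; case: (ltnP j (size la)) => [jla|?]; last first.
  by rewrite [X in X <= _]nth_default.
have geq_trans : transitive geq by move=> a b c /= ba ac; apply: leq_trans ac ba.
apply: (sorted_leq_nth geq_trans leqnn 0 s) => //.
exact: leq_ltn_trans ij jla.
Qed.

Implicit Types t : 'S_N.

Lemma box_inj t k l : row_of la t k = row_of la t l ->
  col_of la t k = col_of la t l -> k = l.
Proof.
rewrite /row_of /col_of => er ec; apply: (@perm_inj _ t^-1%g); apply: val_inj.
by rewrite /= -[LHS](reshape_indexK la) er ec reshape_indexK.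
Qed.

Lemma col_of_lt t k : col_of la t k < nth 0 la (row_of la t k).
Proof. by apply: reshape_offsetP; rewrite sumn_part. Qed.

Lemma box_ex t r c : c < nth 0 la r ->
  exists2 k, row_of la t k = r & col_of la t k = c.
Proof.
move=> h; have hN : flatten_index la r c < N.
  by rewrite -sumn_part flatten_indexP.
by exists (t (Ordinal hN)); rewrite /row_of /col_of permK /=
  ?flatten_indexKl ?flatten_indexKr.
Qed.

Lemma card_injective_leq (T : finType) (A : {set T}) (f : T -> nat) b :
  {in A &, injective f} -> (forall x, x \in A -> f x < b) -> #|A| <= b.
Proof.
move=> f_inj f_lt; rewrite cardE -(size_map f) -[b in _ <= b](size_iota 0).
apply: uniq_leq_size => [|y /mapP[x]]; rewrite ?mem_enum.
  by rewrite map_inj_in_uniq ?enum_uniq // => x y; rewrite !mem_enum; apply: f_inj.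
by move=> Ax ->; rewrite mem_iota f_lt.
Qed.

(* The entry k of a fibre of a moves to the place in this fibre where b takes *)
(* the value #{l in the fibre of k | r l < r k}, which is at most r k.        *)
Lemma sort_fibres (D : eqType) (a : 'I_N -> D) (b r : 'I_N -> nat) :
    (forall k i, i < #|[set l | a l == a k]| ->
       exists k', a k' = a k /\ b k' = i) ->
    (forall k l, r k = r l -> a k = a l -> k = l) ->
  exists p : 'S_N, forall k, a (p k) = a k /\ b (p k) <= r k.
Proof.
move=> b_onto r_inj; pose A k := [set l | (a l == a k) && (r l < r k)].
have A_le k : #|A k| <= r k.
  apply: (@card_injective_leq _ _ r) => [l l'|l]; rewrite !inE; last by case/andP.
  by move=> /andP[/eqP el _] /andP[/eqP el' _] /r_inj; apply; rewrite el el'.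
have A_lt k : #|A k| < #|[set l | a l == a k]|.
  apply: proper_card; apply/properP; split.
    by apply/subsetP => l; rewrite !inE => /andP[].
  by exists k; rewrite !inE ?eqxx ?ltnn.
have /fin_all_exists[f fP] k := b_onto k _ (A_lt k).
have A_ltn k l : a k = a l -> r k < r l -> #|A k| < #|A l|.
  move=> ea lt; apply: proper_card; apply/properP; split.
    by apply/subsetP => x; rewrite !inE ea => /andP[-> /ltn_trans->].
  by exists k; rewrite !inE ?ea ?eqxx ?ltnn.
have f_inj : injective f.
  move=> k l e; have ea : a k = a l.
    by case: (fP k) (fP l) => <- _ [<- _]; rewrite e.
  have eA : #|A k| = #|A l| by case: (fP k) (fP l) => _ <- [_ <-]; rewrite e.
  case: (ltngtP (r k) (r l)) => [lt|lt|/r_inj]; last exact.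
    by have := A_ltn _ _ ea lt; rewrite eA ltnn.
  by have := A_ltn _ _ (esym ea) lt; rewrite eA ltnn.
by exists (perm f_inj) => k; rewrite permE; case: (fP k) => -> ->.
Qed.

(** The columns of a partition diagram have no gaps, so each column can be refilled from the top in
    the order given by [r]. *)
Lemma sort_columns t (r : 'I_N -> nat) :
  (forall k l, r k = r l -> col_of la t k = col_of la t l -> k = l) ->
  exists2 p, p \in col_stab la t & forall k, row_of la t (p k) <= r k.
Proof.
move=> r_inj; have [|p pP] := sort_fibres (b := row_of la t) _ r_inj.
  move=> k i lt_i; have lt_c : col_of la t k < nth 0 la i.
    (* If row [i] did not reach this column, no later row would, and the column would have at most
       [i] entries. *)
    rewrite ltnNge; apply/negP => le_c; move: lt_i; rewrite ltnNge => /negP; apply.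
    apply: (@card_injective_leq _ _ (row_of la t)) => [l l'|l]; rewrite !inE.
      by move=> /eqP cl /eqP cl' /box_inj; apply; rewrite cl cl'.
    move=> /eqP cl; rewrite ltnNge; apply/negP => /nth_part_leq.
    by apply/negP; rewrite -ltnNge (leq_ltn_trans le_c) // -cl col_of_lt.
  by have [k' rk ck] := box_ex t lt_c; exists k'.
exists p => [|k]; last by case: (pP k).
by rewrite inE; apply/forallP => k; case: (pP k) => ->.
Qed.

Lemma sort_rows t (c : 'I_N -> nat) :
  (forall k l, c k = c l -> row_of la t k = row_of la t l -> k = l) ->
  exists p : 'S_N, forall k, col_of la t (p k) <= c k.
Proof.
move=> c_inj; have [|p pP] := sort_fibres (b := col_of la t) _ c_inj.
  move=> k i lt_i; have lt_c : i < nth 0 la (row_of la t k).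
    apply: leq_trans lt_i _.
    apply: (@card_injective_leq _ _ (col_of la t)) => [l l'|l]; rewrite !inE.
      by move=> /eqP rl /eqP rl' /box_inj; apply; rewrite rl rl'.
    by move=> /eqP <-; apply: col_of_lt.
  by have [k' rk ck] := box_ex t lt_c; exists k'.
by exists p => k; case: (pP k).
Qed.

Lemma reshape_index_lt sh i r : i < sumn sh ->
  (reshape_index sh i < r) = (i < sumn (take r sh)).
Proof.
elim: sh i r => [|s sh IHsh] //= i [|r] //; rewrite /reshape_index /= => lt_i.
rewrite subn_eq0; case: (ltnP i s) => [lt|le] /=.
  by rewrite (leq_trans lt) ?leq_addr.
rewrite ltnS -ltn_subLR // -IHsh ?ltn_subLR //.
by rewrite /reshape_index subSn.
Qed.

Lemma card_rows_lt t r : #|[set k | row_of la t k < r]| = sumn (take r la).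
Proof.
set s := sumn _; have sN : s <= N.
  by rewrite -sumn_part -[X in _ <= sumn X](cat_take_drop r) sumn_cat leq_addr.
rewrite -[RHS]card_ord -(card_imset _ (@perm_inj _ t^-1%g)).
have w_inj : injective (widen_ord sN) by move=> i j /(congr1 val) /= /val_inj.
rewrite -[RHS](card_imset _ w_inj).
apply: eq_card => j; apply/imsetP/imsetP => [[k]|[i _ ->]].
  rewrite inE /row_of reshape_index_lt ?sumn_part // => lt ->.
  by exists (Ordinal lt) => //; apply: val_inj.
exists (t (widen_ord sN i)); rewrite ?permK // inE /row_of permK.
by rewrite reshape_index_lt ?sumn_part //= (leq_trans (ltn_ord i)).
Qed.

End Tableaux.

(** Equal leading parts cancel from the partial sums, so the first difference is decided by a single
    inequality. Nonzero parts prevent [ka] from being [la] extended by zeros. *)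
Lemma lexi_of_dominance (ka la : seq nat) : 0%N \notin ka ->
  (forall r, sumn (take r ka) <= sumn (take r la))%N ->
  ((ka : seqlexi nat) <= (la : seqlexi nat))%O.
Proof.
elim: ka la => [|x ka IHka] [|y la] // nz h.
  by have := h 1%N; rewrite /= take0 /= addn0 leqn0 => /eqP x0; rewrite x0 inE in nz.
rewrite lexi_cons; have := h 1%N; rewrite /= !take0 /= !addn0 => le_xy.
rewrite leEnat le_xy; apply/implyP => le_yx.
have {}le_yx : x = y by apply/eqP; rewrite eqn_leq le_xy.
apply: IHka => [|r]; first by rewrite inE negb_or in nz; case/andP: nz.
by have := h r.+1; rewrite /= le_yx leq_add2l.
Qed.

(** * Column antisymmetrizers and irreducibility of Specht modules *)

Section SpechtModule.

Variables (F : numFieldType) (N : nat).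

Lemma rank_asum_submod n (rG : mx_representation F [set: 'S_N] n) U
    (modU : mxmodule rG U) A :
  \rank (asum (submod_repr modU) A) = \rank (U *m asum rG A).
Proof.
rewrite -(eqmxMr (asum rG A) (val_submod1 U)).
have -> : val_submod 1%:M *m asum rG A = val_submod (asum (submod_repr modU) A).
  rewrite /asum mulmx_sumr linear_sum; apply: eq_bigr => p _.
  by rewrite -scalemxAr [RHS]linearZ -val_submodJ ?inE // mul1mx.
by rewrite /val_submod /= mxrankMfree ?row_base_free.
Qed.

Lemma eq_tabloid (ka : seq nat) (u v : 'S_N) :
  (forall k, row_of ka u k = row_of ka v k) -> tabloid ka u = tabloid ka v.
Proof.
by move=> e; apply/setP => x; rewrite !inE; apply: eq_forallb => k; rewrite e.
Qed.

Lemma tabloid_eq (ka : seq nat) (u v : 'S_N) :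
  tabloid ka u = tabloid ka v -> forall k, row_of ka u k = row_of ka v k.
Proof.
move=> e k; have : u \in tabloid ka v by rewrite -e inE; apply/forallP.
by rewrite inE => /forallP/(_ k)/eqP.
Qed.

Lemma tabloid_vec_asum0 (ka : seq nat) (A : {group 'S_N}) u k l : k != l ->
  tperm k l \in A -> row_of ka u k = row_of ka u l ->
  tabloid_vec F ka (tabloid ka u) *m asum (tabloid_repr F N ka) A = 0.
Proof.
move=> neq At er; set v := tabloid_vec _ _ _.
have e : v *m tabloid_mx F ka (tperm k l) = v.
  rewrite tabloid_vecM ?tabloid_in // -tabloidM; congr tabloid_vec.
  apply: eq_tabloid => x; rewrite row_ofM tpermV.
  by case: tpermP => // ->.
have := congr1 (mulmx v) (asumMl (tabloid_repr F N ka) At).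
rewrite /= mulmxA e odd_tperm neq expr1 scaleN1r mulmxN => /eqP.
by rewrite -addr_eq0 -mulr2n -scaler_nat scaler_eq0 pnatr_eq0 => /eqP.
Qed.

Variable la : seq nat.
Hypothesis la_part : is_partition N la.

Lemma tperm_cstab (D : eqType) (c : 'I_N -> D) k l :
  c k = c l -> tperm k l \in cstab c.
Proof. by move=> e; apply/cstabP => x; case: tpermP => // ->. Qed.

Lemma row_asum_tabloid (ka : seq nat) i (A : {set 'S_N}) :
  row i (asum (tabloid_repr F N ka) A)
    = tabloid_vec F ka (enum_val i) *m asum (tabloid_repr F N ka) A.
Proof.
rewrite -[X in row i X]mul1mx row_mul; congr (_ *m _).
by apply/rowP => j; rewrite !mxE (inj_eq enum_val_inj).
Qed.

Lemma asum_tabloid_neq0 (ka : seq nat) (D : eqType) (c : 'I_N -> D) :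
  asum (tabloid_repr F N ka) (cstab c) != 0 ->
  exists u : 'S_N, forall k l, row_of ka u k = row_of ka u l -> c k = c l -> k = l.
Proof.
move=> nz.
pose good (u : 'S_N) := [forall k, forall l, (row_of ka u k == row_of ka u l) ==>
  (c k == c l) ==> (k == l)].
case: (pickP good) => [u gu|bad].
  exists u => k l er ec; apply/eqP.
  by move/forallP/(_ k)/forallP/(_ l): gu; rewrite er ec !eqxx.
case/eqP: nz; apply/row_matrixP => i; rewrite row0 row_asum_tabloid.
have /imsetP[u _ ->] := enum_valP i.
have /negbT := bad u; rewrite negb_forall => /existsP[k].
rewrite negb_forall => /existsP[l]; rewrite !negb_imply.
case/and3P => /eqP er /eqP ec neq.
rewrite (@tabloid_vec_asum0 ka (cstab_group c) u k l neq _ er) //.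
exact: tperm_cstab.
Qed.

(** A tabloid that survives has rows meeting each column of [t] at most once. Sorting the columns
    then moves its first r rows into the first r rows of [t], so [la] dominates [ka]. *)
Lemma lexi_of_asum_tabloid (ka : seq nat) (t : 'S_N) : is_partition N ka ->
  asum (tabloid_repr F N ka) (col_stab la t) != 0 ->
  ((ka : seqlexi nat) <= (la : seqlexi nat))%O.
Proof.
move=> ka_part /(asum_tabloid_neq0 (c := col_of la t))[u hu].
have [p _ le_p] := sort_columns la_part hu.
apply: lexi_of_dominance => [|r]; first by case/and3P: ka_part.
rewrite -(card_rows_lt ka_part u) -(card_rows_lt la_part t).
rewrite -(card_imset _ (@perm_inj _ p)); apply: subset_leq_card.
by apply/subsetP => _ /imsetP[k + ->]; rewrite !inE; apply: leq_ltn_trans.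
Qed.

Lemma polytabloidE (t : 'S_N) : polytabloid F la t =
  tabloid_vec F la (tabloid la t) *m asum (tabloid_repr F N la) (col_stab la t).
Proof.
rewrite /asum mulmx_sumr; apply: eq_bigr => p _.
by rewrite -scalemxAr tabloid_vecM ?tabloid_in // tabloidM.
Qed.

(** A tabloid is killed if two letters share a row of it and a column of [t]. Otherwise a column
    permutation of [t] carries it to the tabloid of [t], and its image is the polytabloid up to
    sign. *)
Lemma asum_tabloid_sub (t : 'S_N) :
  (asum (tabloid_repr F N la) (col_stab la t) <= polytabloid F la t)%MS.
Proof.
apply/row_subP => i; rewrite row_asum_tabloid.
have /imsetP[u _ ->] := enum_valP i.
have [/existsP[k /existsP[l /and3P[neq /eqP er /eqP ec]]]|/negP ok] :=
  boolP [exists k, exists l, [&& k != l, row_of la u k == row_of la u l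
                               & col_of la t k == col_of la t l]].
  rewrite (@tabloid_vec_asum0 la (cstab_group (col_of la t)) u k l neq _ er) ?sub0mx //.
  exact: tperm_cstab.
have [|p Cp le_p] := @sort_columns _ _ la_part t (row_of la u).
  move=> k l er ec; apply/eqP/negPn/negP => neq; apply: ok.
  by apply/existsP; exists k; apply/existsP; exists l; rewrite neq er ec !eqxx.
have sum_row (v : 'S_N) :
    (\sum_(k < N) row_of la v k = \sum_(k < N) reshape_index la k)%N.
  by rewrite [RHS](reindex_inj (@perm_inj _ v^-1%g)).
(* Row numbers only decrease, but their total is the same for every tableau of this shape, so none
   changes. *)
have e k : row_of la t (p k) = row_of la u k.
  apply/eqP; have := @leqif_sum _ predT _ _ _ (fun i _ => leqif_eq (le_p i)).
  rewrite sum_row -(reindex_inj (@perm_inj _ p) (P := predT) (F := row_of la t)).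
  by rewrite sum_row => /leqif_refl/forallP/(_ k).
have -> : tabloid la u = tabloid la t :* p^-1%g.
  by rewrite -tabloidM; apply: eq_tabloid => k; rewrite row_ofM invgK e.
have Cp' : p^-1%g \in cstab_group (col_of la t) by rewrite groupV.
rewrite -tabloid_vecM ?tabloid_in // -mulmxA.
rewrite (asumMl (tabloid_repr F N la) Cp') -scalemxAr scalemx_sub //.
by rewrite polytabloidE.
Qed.

(** A column permutation that also preserves rows is the identity, so the tabloid of [t] has
    coefficient 1. *)
Lemma polytabloid_neq0 (t : 'S_N) : polytabloid F la t != 0.
Proof.
apply/eqP => /rowP/(_ (enum_rank_in (tabloid_in la t) (tabloid la t))).
rewrite mxE summxE (bigD1 1%g) ?(group1 (cstab_group _)) //= !mxE.
rewrite enum_rankK_in ?tabloid_in // mulg1 eqxx odd_perm1 mulr1 big1 ?addr0.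
  by move/eqP; rewrite oner_eq0.
move=> p /andP[/cstabP Cp neq]; rewrite !mxE enum_rankK_in ?tabloid_in //.
case: eqP => [/tabloid_eq er|]; last by rewrite mulr0.
case/eqP: neq; apply/permP => k; rewrite perm1; apply: (@box_inj _ la t).
  by rewrite -er row_ofM permK.
exact: Cp.
Qed.

Lemma polytabloid_sub (t : 'S_N) : (polytabloid F la t <= specht_mx F N la)%MS.
Proof. by rewrite (sumsmx_sup t) // genmxE. Qed.

Lemma polytabloid_asum (t : 'S_N) :
  polytabloid F la t *m asum (tabloid_repr F N la) (col_stab la t)
    = #|col_stab la t|%:R *: polytabloid F la t.
Proof.
rewrite polytabloidE -mulmxA.
by rewrite (asumM (tabloid_repr F N la) (cstab_group (col_of la t))) scalemxAr.
Qed.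

Lemma natr_col_stab_neq0 (t : 'S_N) : (#|col_stab la t|%:R : F) != 0.
Proof. by rewrite pnatr_eq0 -lt0n (cardG_gt0 (cstab_group (col_of la t))). Qed.

Lemma rank_asum_specht (t : 'S_N) :
  \rank (asum (specht F N la) (col_stab la t)) = 1%N.
Proof.
rewrite rank_asum_submod; apply/eqP; rewrite eqn_leq; apply/andP; split.
  apply: (@leq_trans (\rank (polytabloid F la t))); last exact: rank_leq_row.
  exact/mxrankS/(submx_trans (submxMl _ _))/asum_tabloid_sub.
rewrite lt0n mxrank_eq0; apply: contraNneq (polytabloid_neq0 t) => e0.
rewrite -submx0 -(eqmx_scale _ (natr_col_stab_neq0 t)) -polytabloid_asum -e0.
exact/submxMr/polytabloid_sub.
Qed.

Lemma pchar'S_num : [pchar F]^'.-group [set: 'S_N].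
Proof. by apply/pgroupP => p _; rewrite inE /= pchar_num. Qed.

(** James's submodule argument: any submodule not killed by the antisymmetrizer contains a
    polytabloid, hence the Specht module. If [U] is killed, its Maschke complement [W] is not, so
    [U] lies in [W] and vanishes. *)
Lemma specht_simple : mxsimple (tabloid_repr F N la) (specht_mx F N la).
Proof.
split; first exact: specht_module.
  by apply: contraNneq (polytabloid_neq0 1) => e; rewrite -submx0 -e polytabloid_sub.
move=> U modU sUS nzU.
have all_t V t : mxmodule (tabloid_repr F N la) V ->
    (polytabloid F la t <= V)%MS -> (specht_mx F N la <= V)%MS.
  move=> modV tV; apply/sumsmx_subP => u _; rewrite genmxE.
  rewrite -[u](mulKVg t) -polytabloidM.
  by have /mxmoduleP/(_ (t^-1 * u)%g (in_setT _)) := modV; apply/submx_trans/submxMr.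
have [W modW defUW dxUW] := mx_Maschke_pchar _ pchar'S_num modU (submx1 U).
set b := asum (tabloid_repr F N la) (col_stab la 1%g).
have subMb V : (V *m b <= polytabloid F la 1)%MS.
  exact: submx_trans (submxMl _ _) (asum_tabloid_sub 1).
have modb V : mxmodule (tabloid_repr F N la) V -> (V *m b <= V)%MS.
  move=> modV; rewrite mulmx_sumr summx_sub // => p _.
  by rewrite -scalemxAr scalemx_sub // (mxmoduleP modV) ?inE.
have [Ub0|nzUb] := eqVneq (U *m b) 0.
  have /(all_t _ _ _ modW) sSW : (polytabloid F la 1 <= W)%MS.
    apply: submx_trans (modb _ W modW).
    rewrite -(eqmx_scale _ (natr_col_stab_neq0 1)) -polytabloid_asum.
    apply: (@submx_trans _ _ _ _ _ _ ((U + W)%MS *m b)).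
      by rewrite submxMr // defUW submx1.
    by rewrite addsmxMr Ub0 adds0mx.
  case/eqP: nzU; apply/eqP; rewrite -submx0 -(mxdirect_addsP dxUW) sub_capmx.
  by rewrite submx_refl (submx_trans sUS).
apply: (all_t _ U 1%g) => //; apply: submx_trans (modb _ U modU).
rewrite -(mxrank_leqif_sup (subMb _ U)).
rewrite eqn_leq mxrankS ?subMb //= (leq_trans (rank_leq_row _)) //.
by rewrite lt0n mxrank_eq0.
Qed.

Lemma specht_irr : mx_irreducible (specht F N la).
Proof. exact/submod_mx_irr/specht_simple. Qed.

Lemma lexi_of_asum_specht (ka : seq nat) (t : 'S_N) : is_partition N ka ->
  asum (specht F N ka) (col_stab la t) != 0 ->
  ((ka : seqlexi nat) <= (la : seqlexi nat))%O.
Proof.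
move=> ka_part nz; apply: (lexi_of_asum_tabloid (t := t) ka_part).
apply: contraNneq nz => e0.
by rewrite -mxrank_eq0 rank_asum_submod e0 mulmx0 mxrank0.
Qed.

End SpechtModule.

Lemma specht_inj (F : numFieldType) N ka la :
  is_partition N ka -> is_partition N la ->
  mx_rsim (specht F N ka) (specht F N la) -> ka = la.
Proof.
move=> ka_part la_part sim; apply: (@le_anti _ (seqlexi nat)); apply/andP; split.
  apply: (@lexi_of_asum_specht F N la la_part ka 1%g ka_part).
  by rewrite -mxrank_eq0 (rank_asum_rsim _ sim) rank_asum_specht.
apply: (@lexi_of_asum_specht F N ka ka_part la 1%g la_part).
by rewrite -mxrank_eq0 -(rank_asum_rsim _ sim) rank_asum_specht.
Qed.

(** * Every irreducible module is a Specht module *)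

Section CycleType.

Local Open Scope nat_scope.

Variable N : nat.
Implicit Types s : 'S_N.

(** Each orbit is written as a cycle starting at a picked point; sorting by decreasing length makes
    the shape a partition. *)
Definition cycles s : seq (seq 'I_N) :=
  sort (relpre size geq)
    [seq oapp (fun x => traject s x #|A|) [::] [pick x in A]
       | A : {set 'I_N} <- enum (porbits s)].

Definition cycle_type s : seq nat := shape (cycles s).

Lemma cycle_porbit s (A : {set 'I_N}) : A \in porbits s ->
  exists2 x, A = porbit s x & oapp (fun x => traject s x #|A|) [::] [pick x in A]
                              = traject s x #|porbit s x|.
Proof.
case/imsetP => y _ ->; case: pickP => [x|/(_ y)]; last by rewrite porbit_id.
by rewrite -eq_porbit_mem => /eqP e; exists x => //=; rewrite e.
Qed.

Lemma mem_cycles s c : c \in cycles s -> exists x, c = traject s x #|porbit s x|.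
Proof.
rewrite mem_sort => /mapP[A]; rewrite mem_enum => /cycle_porbit[x _ -> ->].
by exists x.
Qed.

Lemma sumn_cycle_type s : sumn (cycle_type s) = N.
Proof.
rewrite (perm_sumn (s2 := [seq #|A| | A : {set 'I_N} <- enum (porbits s)])).
  rewrite sumnE big_map big_enum /= -[RHS]card_ord -sum1_card.
  rewrite (partition_big_imset (porbit s)) /=; apply: eq_bigr => A PA.
  rewrite -sum1_card; apply: eq_bigl => x.
  by case/imsetP: PA => y _ ->; rewrite eq_porbit_mem.
rewrite (permPl (perm_map _ (permEl (perm_sort _ _)))) -map_comp.
rewrite (_ : map _ _ = [seq #|A| | A : {set 'I_N} <- enum (porbits s)]) //.
apply/eq_in_map => A; rewrite mem_enum => /cycle_porbit[x eA /= ->].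
by rewrite size_traject eA.
Qed.

Lemma cycle_type_part s : is_partition N (cycle_type s).
Proof.
apply/and3P; split; last by rewrite sumn_cycle_type.
  rewrite /cycle_type /shape sorted_map; apply: sort_sorted => a b /=.
  exact: leq_total.
apply/mapP => -[c /mem_cycles[x ->]]; rewrite size_traject => /esym/eqP.
by rewrite (negPf (card_porbit_neq0 s x)).
Qed.

Lemma size_flatten_cycles s : size (flatten (cycles s)) = N.
Proof. by rewrite size_flatten sumn_cycle_type. Qed.

Lemma uniq_flatten_cycles s : uniq (flatten (cycles s)).
Proof.
apply: (@leq_size_uniq _ (enum 'I_N)); rewrite ?enum_uniq //; last first.
  by rewrite size_flatten_cycles -cardE card_ord.
move=> x _; apply/flattenP; have [y e ey] : exists2 y, porbit s x = porbit s y &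
    traject s y #|porbit s y| \in cycles s.
  have Px : porbit s x \in porbits s by apply: imset_f.
  have [y e ey] := cycle_porbit Px; exists y => //.
  by rewrite mem_sort -ey; apply/mapP; exists (porbit s x); rewrite ?mem_enum.
by exists (traject s y #|porbit s y|) => //; rewrite -porbit_traject -e porbit_id.
Qed.

Definition listing s : 'I_N -> 'I_N := fun j => nth j (flatten (cycles s)) j.

Lemma listing_inj s : injective (listing s).
Proof.
move=> i j /eqP; rewrite /listing (set_nth_default j) ?size_flatten_cycles //.
by rewrite nth_uniq ?size_flatten_cycles ?uniq_flatten_cycles // => /eqP/val_inj.
Qed.

(** In the concatenated cycles [s] rotates each row by one place, a rule that involves [s] only
    through its cycle type; this yields conjugacy. *)
Lemma perm_listing s (j : 'I_N) : s (listing s j) =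
  let sh := cycle_type s in let r := reshape_index sh j in
  nth j (flatten (cycles s))
    (flatten_index sh r ((reshape_offset sh j).+1 %% nth 0 sh r)).
Proof.
rewrite /listing /= nth_flatten -/(cycle_type s).
set r := reshape_index _ _; set c := reshape_offset _ _.
have hj : j < sumn (cycle_type s) by rewrite sumn_cycle_type.
have hr : r < size (cycles s).
  by have := reshape_indexP hj; rewrite /cycle_type size_map.
have hc : c < nth 0 (cycle_type s) r := reshape_offsetP hj.
have hm : c.+1 %% nth 0 (cycle_type s) r < nth 0 (cycle_type s) r.
  by rewrite ltn_mod (leq_ltn_trans _ hc).
rewrite nth_flatten flatten_indexKl // flatten_indexKr //.
have [x ex] := mem_cycles (mem_nth [::] hr).
have eN : nth 0 (cycle_type s) r = #|porbit s x| by rewrite nth_shape ex size_traject.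
rewrite ex; rewrite eN in hc hm *.
have nT i : i < #|porbit s x| -> nth j (traject s x #|porbit s x|) i = iter i s x.
  by move=> lt; rewrite (set_nth_default x) ?size_traject // nth_traject.
rewrite !nT // -iterS.
move: hc; rewrite leq_eqVlt => /predU1P[->|lt]; last by rewrite modn_small.
by rewrite modnn iter_porbit.
Qed.

Lemma cycle_type_conj s s' : cycle_type s = cycle_type s' ->
  s' \in s ^: [set: 'S_N].
Proof.
move=> e; pose u := perm (@listing_inj s); pose u' := perm (@listing_inj s').
apply/imsetP; exists (u^-1 * u')%g; first exact: in_setT.
rewrite conjgE; apply: (mulgI (u^-1 * u')%g); rewrite !mulgA mulgV mul1g.
apply/permP => k; rewrite -[k](permKV u); set j := u^-1%g k.
have uE v (i : 'I_N) : perm (@listing_inj v) i = listing v i by rewrite permE.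
rewrite !permM permK !uE !perm_listing -e /=.
set i := flatten_index _ _ _; have hi : i < N.
  rewrite -(sumn_cycle_type s) flatten_indexP // ltn_mod.
  by rewrite (leq_ltn_trans _ (reshape_offsetP _)) ?sumn_cycle_type.
have nE v : nth j (flatten (cycles v)) i = listing v (Ordinal hi).
  by apply: set_nth_default; rewrite size_flatten_cycles.
by rewrite !nE -(uE s) permK.
Qed.

End CycleType.

(** * At most as many irreducibles as conjugacy classes *)

Section IrrepCount.

Variables (F : numFieldType) (gT : finGroupType) (G : {group gT}).
Hypothesis F'G : [pchar F]^'.-group G.
Variable sG : irrType F G.

(** The identities of the Wedderburn components are orthogonal and central, hence independent in the
    centre of the group ring, which the class sums span. The field need not be splitting for this
    inequality. *)
Lemma card_irr_leq_classes : (#|{: sG}| <= #|classes G|)%N.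
Proof.
pose e (i : sG) := Wedderburn_id i.
have e_id i : mxring_id (Wedderburn_subring i) (e i) by apply: Wedderburn_is_id_pchar.
have e_mul i j : i != j -> e i *m e j = 0.
  by move=> neq; apply: (Wedderburn_mulmx0 neq); apply: Wedderburn_id_mem.
have e_center i : (e i \in 'Z(group_ring F G))%MS.
  have sumR : (\sum_i Wedderburn_subring i :=: group_ring F G)%MS :=
    Wedderburn_sum_pchar sG F'G.
  rewrite sub_capmx -{1}sumR (sumsmx_sup i) ?Wedderburn_id_mem //=.
  apply/cent_mxP => A; rewrite -sumR => /memmx_sumsP[B -> RB].
  rewrite mulmx_suml mulmx_sumr; apply: eq_bigr => j _.
  have [<-|neq] := eqVneq i j.
    by have [_ _ l r] := e_id i; rewrite l ?r.
  rewrite (Wedderburn_mulmx0 neq (Wedderburn_id_mem i)) //.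
  by rewrite (Wedderburn_mulmx0 _ (RB j) (Wedderburn_id_mem i)) // eq_sym.
pose E := \matrix_(k < #|{: sG}|) mxvec (e (enum_val k)).
have E_free : row_free E.
  rewrite -kermx_eq0; apply/rowV0P => v /sub_kermxP; rewrite mulmx_sum_row => v0.
  apply/rowP => k; rewrite mxE; have [nz _ _ _] := e_id (enum_val k).
  have : vec_mx (\sum_i v 0 i *: row i E) *m e (enum_val k) = 0.
    by rewrite v0 linear0 mul0mx.
  rewrite linear_sum mulmx_suml (bigD1 k) //= big1 => [|j neq]; last first.
    rewrite linearZ /= rowK mxvecK -scalemxAl e_mul ?scaler0 //.
    by rewrite (inj_eq enum_val_inj).
  rewrite addr0 linearZ /= rowK mxvecK -scalemxAl; have [_ Re l _] := e_id (enum_val k).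
  by rewrite l // => /eqP; rewrite scaler_eq0 (negPf nz) orbF => /eqP.
rewrite -(eqP E_free).
apply: leq_trans (rank_leq_row (classg_base F G)).
apply: mxrankS; rewrite classg_base_center; apply/row_subP => k.
by rewrite rowK e_center.
Qed.

End IrrepCount.

(** Distinct classes have distinct cycle types and so nonisomorphic Specht modules; by the bound on
    the number of irreducibles these are all of them. *)
Lemma irr_specht (F : numFieldType) (N n : nat)
    (rG : mx_representation F [set: 'S_N] n) : mx_irreducible rG ->
  exists2 la, is_partition N la & mx_rsim rG (specht F N la).
Proof.
move=> irrG; apply: NNPP => no.
suff : false by [].
have F'S := pchar'S_num F N.
apply: (@socle_exists F _ [set: 'S_N] _ (regular_repr F [set: 'S_N])) => sG.
pose cls (k : 'I_#|classes [set: 'S_N]|) : 'S_N := repr (enum_val k).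
pose f (k : 'I_#|classes [set: 'S_N]|) : sG :=
  irr_comp sG (specht F N (cycle_type (cls k))).
have clsE k : enum_val k = cls k ^: [set: 'S_N].
  have /imsetP[x _ e] := enum_valP k.
  by rewrite /cls e (class_eqP (mem_repr _ (class_refl _ _))).
have f_inj : injective f.
  move=> k l e; apply: enum_val_inj; rewrite !clsE.
  apply/esym/class_eqP/cycle_type_conj.
  apply: (@specht_inj F N); try exact: cycle_type_part.
  have sim k' := rsim_irr_comp_pchar sG F'S (specht_irr F (cycle_type_part (cls k'))).
  by apply: mx_rsim_trans (sim k) _; rewrite -/(f k) e; apply/mx_rsim_sym/sim.
have /codomP[k e] : irr_comp sG rG \in codom f.
  have : (#|{: sG}| <= #|codom f|)%N.
    by rewrite card_codom // card_ord card_irr_leq_classes.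
  move=> le; suff -> : codom f =i predT by [].
  by apply/subset_cardP; [apply/eqP; rewrite eqn_leq max_card | apply/subsetP].
case: no; exists (cycle_type (cls k)); first exact: cycle_type_part.
apply: mx_rsim_trans (rsim_irr_comp_pchar sG F'S irrG) _.
rewrite e; apply: mx_rsim_sym; apply: (rsim_irr_comp_pchar sG F'S).
exact: specht_irr (cycle_type_part _).
Qed.

(** * Multiplicities *)

Section DirectSums.

Variables (F : fieldType) (gT : finGroupType) (G : {group gT}).
Implicit Types S V W M : representation F G.

Lemma rsim_castmx n1 n2 (e : n1 = n2) (rG1 : mx_representation F G n1)
    (rG2 : mx_representation F G n2) :
  (forall g, rG2 g = castmx (e, e) (rG1 g)) -> mx_rsim rG1 rG2.
Proof.
case: n2 / e rG2 => rG2 h; exists 1%:M => // [|g _].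
  by rewrite row_free_unit unitmx1.
by rewrite mulmx1 mul1mx h castmx_id.
Qed.

Lemma rsim_daddA V1 V2 V3 :
  mx_rsim (dadd_grepr V1 (dadd_grepr V2 V3)) (dadd_grepr (dadd_grepr V1 V2) V3).
Proof.
apply: (rsim_castmx (e := addnA _ _ _)) => g /=.
have := @block_mxA F _ _ _ _ _ _ (V1 g) 0 0 0 (V2 g) 0 0 0 (V3 g).
by rewrite /= !row_mx0 !col_mx0 => ->; rewrite castmx_comp castmx_id.
Qed.

Lemma rsim_dadd_r V W W' :
  mx_rsim W W' -> mx_rsim (dadd_grepr V W) (dadd_grepr V W').
Proof.
case: W W' => n1 W [n2 W'] sim; have /= e := mxrank_rsim sim.
case: n2 / e W' sim => W' [B _ fB hom] /=.
exists (block_mx 1%:M 0 0 B) => // [|g Gg] /=.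
  by rewrite row_free_unit unitmxE det_ublock det1 mul1r -unitmxE -row_free_unit.
rewrite !mulmx_block !(mulmx0, mul0mx, addr0, add0r, mulmx1, mul1mx).
by rewrite hom.
Qed.

Lemma rsim_dadd_l V V' W :
  mx_rsim V V' -> mx_rsim (dadd_grepr V W) (dadd_grepr V' W).
Proof.
case: V V' => n1 V [n2 V'] sim; have /= e := mxrank_rsim sim.
case: n2 / e V' sim => V' [B _ fB hom] /=.
exists (block_mx B 0 0 1%:M) => // [|g Gg] /=.
  by rewrite row_free_unit unitmxE det_ublock det1 mulr1 -unitmxE -row_free_unit.
rewrite !mulmx_block !(mulmx0, mul0mx, addr0, add0r, mulmx1, mul1mx).
by rewrite hom.
Qed.

Lemma rsim_dadd0 V : mx_rsim V (dadd_grepr (@grepr0 F gT G) V).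
Proof.
apply: (rsim_castmx (e := erefl (0 + rdegree V)%N)) => g /=.
have sh (i : 'I_(0 + rdegree V)) : i = rshift 0 i by apply: val_inj.
by rewrite castmx_id; apply/matrixP => i j; rewrite (sh i) (sh j) block_mxEdr -!sh.
Qed.

Lemma mulnS_grepr S k :
  muln_grepr S k.+1 = dadd_grepr S (muln_grepr S k).
Proof. by rewrite /muln_grepr big_ord_recl. Qed.

Lemma rsim_dadd_submod V U U' (modU : mxmodule V U) (modU' : mxmodule V U') :
  (U + U' :=: 1%:M)%MS -> mxdirect (U + U') ->
  mx_rsim V (dadd_grepr (Representation (submod_repr modU))
                        (Representation (submod_repr modU'))).
Proof.
move=> defV dx; apply: (mx_rsim_trans (mx_rsim_sym
  (rsim_submod1 (mxmodule1 V) (eqmx_refl _)))).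
by apply: (mx_rsim_dadd (rU := Representation (submod_repr modU))
  (rV := Representation (submod_repr modU')) _ defV dx); apply: mx_rsim_refl.
Qed.

End DirectSums.

(** * Multiplicities read off from ranks of antisymmetrizers *)

Section Multiplicities.

Variables (F : numFieldType) (N : nat).
Implicit Types V W M : representation F [set: 'S_N].

Let F'S := pchar'S_num F N.

(** By complete reducibility the signed sum is nonzero on some simple submodule, which is a Specht
    module and a summand. *)
Lemma specht_summand_of_asum V A : asum V A != 0 ->
  exists2 ka, is_partition N ka &
    is_summand (specht F N ka) V /\ asum (specht F N ka) A != 0.
Proof.
move=> nz; apply: NNPP => no; suff : false by [].
apply: (mx_reducible_semisimple (mxmodule1 V) (mx_Maschke_pchar V F'S)).
case=> I U /= simU defV _; case/eqP: nz.
suff U0 i : U i *m asum V A = 0.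
  apply/eqP; rewrite -submx0 -[asum V A]mul1mx -(eqmxMr _ defV) sumsmxMr.
  by apply/sumsmx_subP => i _; rewrite U0 submx_refl.
apply/eqP/negPn/negP => nzU; case: no; have [modU _ _] := simU i.
have [ka ka_part sim] := irr_specht ((submod_mx_irr modU).2 (simU i)).
exists ka => //; split.
  have [U' modU' defU dx] := mx_Maschke_pchar V F'S modU (submx1 _).
  exists (Representation (submod_repr modU')).
  apply: mx_rsim_trans (rsim_dadd_submod modU modU' defU dx) _.
  exact: rsim_dadd_l.
rewrite -mxrank_eq0 -(rank_asum_rsim A sim) rank_asum_submod.
by rewrite mxrank_eq0.
Qed.

Lemma rank_asum_summand S V A : is_summand S V ->
  (\rank (asum S A) <= \rank (asum V A))%N.
Proof.
by case=> M /(rank_asum_rsim A) ->; rewrite rank_asum_dadd leq_addr.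
Qed.

Lemma has_some_multiplicity S V : (0 < rdegree S)%N ->
  exists k, has_multiplicity S V k.
Proof.
move=> S_gt0; have [d] := ubnP (rdegree V); elim: d V => // d IHd V le_d.
have [[M VSM]|no] := classic (is_summand S V); last first.
  exists 0%N, V => //; rewrite /muln_grepr big_ord0; exact: rsim_dadd0.
have [|k [M' simM noM']] := IHd M.
  rewrite ltnS in le_d; apply: leq_trans le_d.
  by rewrite (mxrank_rsim VSM) /= -add1n leq_add2r.
exists k.+1, M' => //; rewrite mulnS_grepr.
apply: mx_rsim_trans VSM _; apply: mx_rsim_trans (rsim_dadd_r _ simM) _.
exact: rsim_daddA.
Qed.

(* The rank of a column antisymmetrizer of shape la only sees constituents    *)
(* labelled by partitions at most la.                                         *)
Lemma lex_min_multiplicity V la : is_partition N la ->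
    asum V (col_stab la 1) != 0 ->
    (forall ka, is_partition N ka -> asum V (col_stab ka 1) != 0 ->
       ((la : seqlexi nat) <= (ka : seqlexi nat))%O) ->
  is_lex_min_constituent V la /\
  has_multiplicity (specht F N la) V (\rank (asum V (col_stab la 1))).
Proof.
move=> la_part nz min_la.
have asum_nz ka W : is_partition N ka -> is_summand (specht F N ka) W ->
    asum W (col_stab ka 1) != 0.
  move=> ka_part /rank_asum_summand le; rewrite -mxrank_eq0 -lt0n.
  by apply: leq_trans (le _); rewrite rank_asum_specht.
have la_summand W : asum W (col_stab la 1) != 0 ->
    (forall B, \rank (asum W B) <= \rank (asum V B))%N ->
  is_summand (specht F N la) W.
  move=> /specht_summand_of_asum[ka ka_part [sumW nzka]] le.
  suff -> : la = ka by [].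
  apply: (@le_anti _ (seqlexi nat)); apply/andP; split.
    apply: min_la => //; rewrite -mxrank_eq0 -lt0n (leq_trans _ (le _)) //.
    by rewrite lt0n mxrank_eq0; apply: asum_nz.
  exact: (@lexi_of_asum_specht F N la la_part ka 1%g ka_part).
split.
  split=> //; first exact: la_summand.
  by move=> ka ka_part /asum_nz nzka; apply: min_la => //; apply: nzka.
have [|k [M simV noM]] := @has_some_multiplicity (specht F N la) V.
  have := rank_leq_row (asum (specht F N la) (col_stab la 1)).
  by rewrite rank_asum_specht.
suff -> : \rank (asum V (col_stab la 1)) = k by exists M.
have rk A : \rank (asum V A)
    = (k * \rank (asum (specht F N la) A) + \rank (asum M A))%N.
  by rewrite (rank_asum_rsim A simV) rank_asum_dadd rank_asum_muln.
rewrite rk rank_asum_specht // muln1.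
have [->|nzM] := eqVneq (asum M (col_stab la 1)) 0; first by rewrite mxrank0 addn0.
by case: noM; apply: la_summand => // B; rewrite rk leq_addl.
Qed.

End Multiplicities.

(** * The Specht modules of (n), (1^n) and (m-1,1) *)

Section SmallSpechts.

Variable F : numFieldType.

(** Treats (n) and (1^n) together: in both cases the polytabloids span a line. *)
Lemma mxtrace_specht_line n la (chi : 'S_n -> F) :
    (forall t, polytabloid F la t = chi t *: polytabloid F la 1) ->
  forall s, \tr (specht F n la s) = chi s.
Proof.
move=> chiE s.
have sS : (specht_mx F n la <= polytabloid F la (1%g : 'S_n))%MS.
  by apply/sumsmx_subP => t _; rewrite genmxE chiE scalemx_sub.
have rk : \rank (specht_mx F n la) = 1%N.
  apply/eqP; rewrite eqn_leq (leq_trans (mxrankS sS) (rank_leq_row _)) /=.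
  rewrite lt0n mxrank_eq0; apply: contraNneq (@polytabloid_neq0 F n la 1) => e.
  by have := @polytabloid_sub F n la 1; rewrite e submx0.
suff -> : (specht F n la s : 'M_(rdegree (specht F n la))) = (chi s)%:M.
  by rewrite mxtrace_scalar /= rk mulr1n.
apply: val_submod_inj; rewrite -[X in val_submod X]mul1mx val_submodJ ?inE //.
rewrite -[in RHS]scalemx1 [RHS]linearZ /=.
have /submxP[w ->] : (val_submod (1%:M : 'M_(\rank (specht_mx F n la)))
                       <= polytabloid F la (1%g : 'S_n))%MS.
  exact: submx_trans (val_submodP _) sS.
by rewrite -mulmxA polytabloidM mul1g chiE scalemxAr.
Qed.

Lemma mxtrace_specht_row n (s : 'S_n) : (0 < n)%N ->
  \tr (specht F n [:: n] s) = 1.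
Proof.
move=> n_gt0.
have row0 (t : 'S_n) k : row_of [:: n] t k = 0%N.
  by apply/eqP; rewrite -leqn0 -ltnS; apply: reshape_indexP; rewrite /= addn0.
apply: (mxtrace_specht_line (chi := fun=> 1)) => t; rewrite scale1r.
have stab1 (u : 'S_n) : col_stab [:: n] u = [set 1%g].
  apply/eqP; rewrite eqEsubset sub1set (group1 (cstab_group _)) andbT.
  apply/subsetP => p /cstabP Cp; rewrite inE; apply/eqP/permP => k.
  by rewrite perm1; apply: (@box_inj _ [:: n] u); rewrite ?row0 ?Cp.
rewrite /polytabloid !stab1 !big_set1 !mulg1.
by congr (_ *: tabloid_vec _ _ _); apply: eq_tabloid => k; rewrite !row0.
Qed.

Lemma mxtrace_specht_column n (s : 'S_n) : (0 < n)%N ->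
  \tr (specht F n (nseq n 1%N) s) = (-1) ^+ s.
Proof.
move=> n_gt0; have part_n : is_partition n (nseq n 1%N).
  rewrite /is_partition sumn_nseq mul1n eqxx andbT; apply/andP; split.
    by case: (n) => // k; elim: k => //= k ->.
  by rewrite mem_nseq andbF.
have col0 (t : 'S_n) k : col_of (nseq n 1%N) t k = 0%N.
  have := col_of_lt part_n t k; rewrite nth_nseq; case: ifP => _ //.
  by rewrite ltnS leqn0 => /eqP.
apply: (mxtrace_specht_line (chi := fun t : 'S_n => (-1) ^+ t)) => t.
have stabT (u : 'S_n) : col_stab (nseq n 1%N) u = [set: 'S_n].
  by apply/setP => p; rewrite !inE; apply/forallP => k; rewrite !col0.
rewrite /polytabloid !stabT scaler_sumr.
rewrite (reindex_inj (mulgI t^-1%g)) /=; apply: eq_big => p; first by rewrite !inE.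
by move=> _; rewrite mulKVg mul1g scalerA odd_permM odd_permV signr_addb.
Qed.

(** * The Specht module of (m-1,1) *)

Section Standard.

Variable m : nat.
Hypothesis m_gt1 : (1 < m)%N.

Let la := [:: m.-1; 1%N].

Let pred_lt : (m.-1 < m)%N.
Proof. by rewrite prednK // ltnW. Qed.
Let lst : 'I_m := Ordinal pred_lt.
Let fst0 : 'I_m := Ordinal (ltnW m_gt1).

Let row_ofE (t : 'S_m) k : row_of la t k = (k == t lst).
Proof.
rewrite /row_of -(inj_eq (@perm_inj _ t^-1%g)) permK -val_eqE /=.
set i := t^-1%g k; have := ltn_ord i; rewrite /reshape_index /= subn_eq0.
case: (ltnP i m.-1) => [lt _|le lt] /=; first by rewrite ltn_eqF.
have -> : val i = m.-1.
  by apply/eqP; rewrite eqn_leq le andbT -ltnS prednK // (ltnW m_gt1).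
by rewrite subSn // subnn eqxx subn_eq0.
Qed.

(** A tabloid of shape (m-1,1) amounts to the letter in its second row, which [t] assigns to the
    last box. *)
Let tabloid_lst (t u : 'S_m) : (tabloid la t == tabloid la u) = (t lst == u lst).
Proof.
apply/eqP/eqP => [/tabloid_eq/(_ (t lst))|e].
  by rewrite !row_ofE eqxx; case: eqP.
by apply: eq_tabloid => k; rewrite !row_ofE e.
Qed.

Let perm2 (k l : 'I_m) : k != l -> exists t : 'S_m, t fst0 = k /\ t lst = l.
Proof.
move=> neq; have neq0 : lst != fst0.
  by rewrite -val_eqE /=; case: (m) m_gt1 => [|[|]].
have neq1 : tperm fst0 k lst != k.
  by rewrite -(inj_eq (@perm_inj _ (tperm fst0 k))) tpermK tpermR.
exists (tperm fst0 k * tperm (tperm fst0 k lst) l)%g.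
by rewrite eq_sym in neq; split; rewrite permM ?tpermL //; apply: tpermD.
Qed.

(** Only the first column has two boxes, so the column stabilizer consists of 1 and one
    transposition. *)
Let polytabloid_standard (t : 'S_m) : polytabloid F la t =
  tabloid_vec F la (tabloid la t)
    - tabloid_vec F la (tabloid la (t * tperm (t fst0) (t lst))).
Proof.
have neq0 : fst0 != lst by rewrite -val_eqE /=; case: (m) m_gt1 => [|[|]].
have cE k : col_of la t k = if k == t lst then 0%N else t^-1%g k.
  rewrite /col_of -(inj_eq (@perm_inj _ t^-1%g)) permK -val_eqE /=.
  set i := t^-1%g k; have := ltn_ord i.
  rewrite /reshape_offset /reshape_index /= subn_eq0.
  case: (ltnP i m.-1) => [lt _|le lt] /=; first by rewrite ltn_eqF // subn0.
  have -> : val i = m.-1.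
    by apply/eqP; rewrite eqn_leq le andbT -ltnS prednK // (ltnW m_gt1).
  by rewrite subSn // subnn eqxx subn_eq0 /= addn0 subnn.
have c_inj k l : k != t lst -> l != t lst -> col_of la t k = col_of la t l -> k = l.
  move=> /negPf nk /negPf nl; rewrite !cE nk nl => /val_inj; exact: perm_inj.
have c0 k : col_of la t k = 0%N -> k = t lst \/ k = t fst0.
  rewrite cE; case: eqP => [|_ e]; first by left.
  by right; rewrite -[k](permKV t); congr (t _); apply: val_inj.
have cl : col_of la t (t lst) = 0%N by rewrite cE eqxx.
have cf : col_of la t (t fst0) = 0%N by rewrite cE (inj_eq perm_inj) (negPf neq0) permK.
have tneq : t fst0 != t lst by rewrite (inj_eq perm_inj).
set tau := tperm _ _.
have stabE : col_stab la t = [set 1%g; tau].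
  apply/setP => p; rewrite !inE; apply/forallP/orP; last first.
    case=> /eqP-> k; rewrite ?perm1 ?eqxx // /tau.
    by case: tpermP => [->|->|]; rewrite ?cl ?cf.
  move=> /(_ _)/eqP Cp; have pfix k : k != t lst -> k != t fst0 -> p k = k.
    move=> nl nf; have nz : col_of la t k != 0%N.
      by apply/eqP => /c0[] e; rewrite e eqxx in nl nf.
    apply: c_inj => //; apply: contraNneq nz => e.
    by rewrite -Cp e cl.
  have [pl|pl] : p (t lst) = t lst \/ p (t lst) = t fst0 by apply: c0; rewrite Cp.
    left; apply/eqP/permP => k; rewrite perm1.
    have [->//|nl] := eqVneq k (t lst).
    have [->|nf] := eqVneq k (t fst0); last exact: pfix.
    have [e|//] : p (t fst0) = t lst \/ p (t fst0) = t fst0 by apply: c0; rewrite Cp.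
    by move: tneq; rewrite -(inj_eq (@perm_inj _ p)) e pl eqxx.
  right; apply/eqP/permP => k.
  have [->|nl] := eqVneq k (t lst); first by rewrite pl tpermR.
  have [->|nf] := eqVneq k (t fst0); last by rewrite tpermD ?pfix // eq_sym.
  rewrite tpermL; have [//|e] : p (t fst0) = t lst \/ p (t fst0) = t fst0.
    by apply: c0; rewrite Cp.
  by move: tneq; rewrite -(inj_eq (@perm_inj _ p)) e pl eqxx.
rewrite /polytabloid stabE big_setU1 ?big_set1 /=; last first.
  rewrite inE eq_sym; apply/eqP => /permP/(_ (t fst0)); rewrite perm1 tpermL => e.
  by rewrite e eqxx in tneq.
by rewrite odd_perm1 expr0 scale1r mulg1 odd_tperm tneq expr1 scaleN1r.
Qed.

Let tabloid_sub_specht (u v : 'S_m) :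
  (tabloid_vec F la (tabloid la u) - tabloid_vec F la (tabloid la v)
     <= specht_mx F m la)%MS.
Proof.
have [e|neq] := eqVneq (u lst) (v lst).
  have /eqP -> : tabloid la u == tabloid la v by rewrite tabloid_lst e.
  by rewrite subrr sub0mx.
rewrite eq_sym in neq; have [t [tf tl]] := perm2 neq.
have := polytabloid_sub F la t; rewrite polytabloid_standard.
have /eqP-> : tabloid la t == tabloid la u by rewrite tabloid_lst tl.
suff /eqP-> : tabloid la (t * tperm (t fst0) (t lst)) == tabloid la v by [].
by rewrite tabloid_lst permM tpermR tf.
Qed.

Let card_tabloids : #|tabloids m la| = m.
Proof.
have lst_tab k : exists t : 'S_m, t lst = k.
  by exists (tperm lst k); rewrite tpermL.
have /fin_all_exists[f fP] := lst_tab.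
rewrite -[RHS]card_ord.
rewrite -(card_imset _ (f := fun k => tabloid la (f k))); last first.
  by move=> k l /eqP; rewrite tabloid_lst !fP => /eqP.
apply: eq_card => A; apply/imsetP/imsetP => [[t _ ->]|[k _ ->]]; last by exists (f k).
by exists (t lst) => //; apply/eqP; rewrite tabloid_lst fP.
Qed.

(** The module lies in the kernel of the coefficient sum, and together with a single tabloid it
    spans everything. *)
Lemma rank_specht_standard : \rank (specht_mx F m la) = m.-1.
Proof.
apply/eqP; rewrite eqn_leq; apply/andP; split.
  have /mxrankS : (specht_mx F m la <= kermx (const_mx 1 : 'cV[F]_#|tabloids m la|))%MS.
    apply/sumsmx_subP => t _; rewrite genmxE; apply/sub_kermxP.
    have sum1 A : A \in tabloids m la ->
        tabloid_vec F la A *m (const_mx 1 : 'cV[F]_#|tabloids m la|) = 1%:M.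
      move=> TA; apply/matrixP => i j; rewrite !ord1 !mxE eqxx.
      rewrite (bigD1 (enum_rank_in TA A)) //= !mxE enum_rankK_in // eqxx mul1r.
      rewrite big1 ?addr0 // => k neq; rewrite !mxE; case: eqP => [e|].
        by case/eqP: neq; apply: enum_val_inj; rewrite enum_rankK_in.
      by rewrite mul0r.
    by rewrite polytabloid_standard mulmxBl !sum1 ?tabloid_in // subrr.
  move=> le; apply: leq_trans le _; rewrite mxrank_ker.
  suff -> : \rank (const_mx 1 : 'cV[F]_#|tabloids m la|) = 1%N.
    by rewrite card_tabloids subn1.
  apply/eqP; rewrite eqn_leq rank_leq_col lt0n mxrank_eq0.
  apply/eqP => /matrixP/(_ (enum_rank_in (tabloid_in la 1) (tabloid la 1)) 0).
  by rewrite !mxE => /eqP; rewrite oner_eq0.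
have : (1%:M <= specht_mx F m la + tabloid_vec F la (tabloid la 1))%MS.
  apply/row_subP => i.
  have -> : row i 1%:M = tabloid_vec F la (enum_val i).
    by apply/rowP => j; rewrite !mxE (inj_eq enum_val_inj).
  have /imsetP[u _ ->] := enum_valP i.
  rewrite -[tabloid_vec _ _ (tabloid la u)](subrK (tabloid_vec F la (tabloid la 1))).
  by rewrite addmx_sub_adds ?tabloid_sub_specht.
move/mxrankS; rewrite mxrank1 {1}card_tabloids => le.
have {}le := leq_trans le (mxrank_adds_leqif _ _).
have {}le := leq_trans le (leq_add (leqnn _) (rank_leq_row _)).
by rewrite addn1 in le; rewrite -ltnS prednK // ltnW.
Qed.

Lemma rank_asum_standard (D : eqType) (c : 'I_m -> D) : injective c ->
  \rank (asum (specht F m la) (cstab c)) = m.-1.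
Proof.
move=> c_inj; have -> : cstab c = [set 1%g].
  apply/setP => p; rewrite in_set1; apply/cstabP/eqP => [h|-> k]; last by rewrite perm1.
  by apply/permP => k; rewrite perm1; apply/c_inj.
rewrite /asum big_set1 odd_perm1 expr0 scale1r repr_mx1 mxrank1.
exact: rank_specht_standard.
Qed.

(** Let [k] and [l] share a colour. Tabloids with another letter in the second row are killed, and
    the two with [k] or [l] there have opposite images. *)
Lemma rank_asum_standard_leq1 (D : eqType) (c : 'I_m -> D) : ~ injective c ->
  (\rank (asum (specht F m la) (cstab c)) <= 1)%N.
Proof.
move=> c_ninj; have [k [l [neq ec]]] : exists k l, k != l /\ c k = c l.
  apply: NNPP => no; apply: c_ninj => k l e; apply/eqP/negPn/negP => neq.
  by apply: no; exists k, l.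
have tau_c : tperm k l \in cstab_group c.
  by apply/cstabP => x; case: tpermP => // ->.
rewrite rank_asum_submod; apply: (leq_trans (mxrankM_maxr _ _)).
set M := tabloid_repr F m la; set b := asum M (cstab c).
have /(_ k)[t tk] : forall x, exists t : 'S_m, t lst = x.
  by move=> x; exists (tperm lst x); rewrite tpermL.
pose v := tabloid_vec F la (tabloid la t) *m b.
suff /mxrankS le : (b <= v)%MS by apply: leq_trans le (rank_leq_row _).
apply/row_subP => i; rewrite row_asum_tabloid; have /imsetP[u _ ->] := enum_valP i.
have [uk|nk] := eqVneq (u lst) k.
  by have /eqP-> : tabloid la u == tabloid la t by rewrite tabloid_lst uk tk.
have [ul|nl] := eqVneq (u lst) l; last first.
  rewrite (tabloid_vec_asum0 F neq tau_c) ?sub0mx // !row_ofE.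
  by rewrite (eq_sym k) (eq_sym l) (negPf nk) (negPf nl).
have /eqP-> : tabloid la u == tabloid la (t * tperm k l).
  by rewrite tabloid_lst permM tk tpermL ul.
rewrite tabloidM -tabloid_vecM ?tabloid_in // -mulmxA (asumMl M tau_c).
by rewrite -scalemxAr scalemx_sub.
Qed.

End Standard.

End SmallSpechts.

(** * Weights of colourings and induced modules *)

Section Weights.

Local Open Scope nat_scope.

Lemma digits_inj K d (f g : 'I_d -> nat) :
  (forall j, f j < K) -> (forall j, g j < K) ->
  \sum_(j < d) f j * K ^ j = \sum_(j < d) g j * K ^ j -> f =1 g.
Proof.
elim: d f g => [|d IHd] f g ltf ltg; first by move=> _ [].
have split_sum h : \sum_(j < d.+1) h j * K ^ j
    = h ord0 + (\sum_(j < d) h (lift ord0 j) * K ^ j) * K.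
  rewrite big_ord_recl muln1 big_distrl /=; congr (_ + _).
  by apply: eq_bigr => j _; rewrite expnS -mulnA [K * _]mulnC.
rewrite !split_sum => e; have e0 : f ord0 = g ord0.
  have := congr1 (modn^~ K) e; rewrite /= ![_ + _ * K]addnC !modnMDl.
  by rewrite !modn_small.
have K0 : 0 < K := leq_ltn_trans (leq0n _) (ltf ord0).
have /IHd h : \sum_(j < d) f (lift ord0 j) * K ^ j
    = \sum_(j < d) g (lift ord0 j) * K ^ j.
  by apply/eqP; rewrite -(eqn_pmul2r K0) -(eqn_add2l (f ord0)) {2}e0 e.
move=> j; case: (unliftP ord0 j) => [i ->|-> //].
by apply: h.
Qed.

Variables (N d K : nat).
Hypothesis ltNK : N < K.

(* The generating monomial of a colouring evaluated at powers of K; since     *)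
(* N < K, it determines how often each colour is used.                        *)
Definition weight (c : {ffun 'I_N -> 'I_d}) : nat := \sum_k K ^ c k.

Lemma weightE c : weight c = \sum_(j < d) #|[set k | c k == j]| * K ^ j.
Proof.
rewrite /weight (partition_big c predT) //=; apply: eq_bigr => j _.
rewrite -sum1_card big_distrl /=; apply: eq_big => [k|k /eqP->].
  by rewrite inE.
by rewrite mul1n.
Qed.

Lemma weight_count c c' : weight c = weight c' ->
  forall j, #|[set k | c k == j]| = #|[set k | c' k == j]|.
Proof.
have lt (c1 : {ffun 'I_N -> 'I_d}) j : #|[set k | c1 k == j]| < K.
  have := max_card (mem [set k | c1 k == j]); rewrite card_ord => le.
  exact: leq_ltn_trans le ltNK.
by rewrite !weightE; apply: digits_inj.
Qed.

Definition recolour (c : {ffun 'I_N -> 'I_d}) (x : 'S_N) := [ffun k => c (x k)].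

Lemma weight_recolour c x : weight (recolour c x) = weight c.
Proof.
rewrite /weight [RHS](reindex_inj (@perm_inj _ x)) /=.
by apply: eq_bigr => k _; rewrite ffunE.
Qed.

Lemma recolour_ex c c' : weight c = weight c' -> exists x, c' = recolour c x.
Proof.
move/weight_count=> h; have : perm_eq (fgraph c') (fgraph c).
  apply/allP => j _ /=; apply/eqP; rewrite -!codom_ffun.
  have cnt (c1 : {ffun 'I_N -> 'I_d}) : count_mem j (codom c1) = #|[set k | c1 k == j]|.
    rewrite codomE count_map -sum1_count big_enum_cond -sum1_card.
    by apply: eq_bigl => k; rewrite !inE.
  by rewrite !cnt h.
case/tuple_permP => p e.
have {}e i : tnth (fgraph c') i = tnth (fgraph c) (p i).
  by rewrite (_ : fgraph c' = [tuple tnth (fgraph c) (p i) | i < #|'I_N|]) ?tnth_mktuple //;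
     apply: val_inj.
pose q k := enum_val (p (enum_rank k)).
have q_inj : injective q by move=> k l /enum_val_inj/perm_inj/enum_rank_inj.
exists (perm q_inj); apply/ffunP => k; rewrite ffunE permE /q.
by have := e (enum_rank k); rewrite !tnth_fgraph enum_rankK.
Qed.

Lemma card_recolour c x :
  #|[set y : 'S_N | recolour c y == recolour c x]| = #|cstab c|.
Proof.
rewrite -(card_lcoset (cstab c) x); apply: eq_card => y.
rewrite mem_lcoset inE; apply/eqP/cstabP => [/ffunP e k|e].
  by have := e (x^-1%g k); rewrite !ffunE permKV permM.
by apply/ffunP => k; rewrite !ffunE -[RHS]e permM permK.
Qed.

End Weights.

(** Colourings of equal weight use every colour equally often, so they form one orbit of S_N; the
    stabilizer has the order of [cstab c0]. *)
Lemma sum_recolour (F : numFieldType) (N d K : nat) (c0 : {ffun 'I_N -> 'I_d})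
    (f : {ffun 'I_N -> 'I_d} -> F) : (N < K)%N ->
  \sum_(x : 'S_N) f (recolour c0 x)
    = #|cstab c0|%:R * \sum_(c | weight K c == weight K c0) f c.
Proof.
move=> ltNK; rewrite (partition_big (recolour c0) predT) //= mulr_sumr.
rewrite [RHS]big_mkcond /=; apply: eq_bigr => c _.
rewrite (eq_bigr (fun=> f c)) => [|x /eqP-> //].
case: eqP => [e|ne]; last first.
  by rewrite big_pred0 // => x; apply/eqP => e; case: ne; rewrite -e weight_recolour.
have [x ->] := recolour_ex ltNK (esym e).
rewrite sumr_const -(card_recolour c0 x) mulr_natl; congr (_ *+ _).
by apply: eq_card => y; rewrite !inE.
Qed.

(** * Ranks of signed sums on induced modules *)

Section InducedRank.

Variables (F : numFieldType) (N d K : nat).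
Variables (H : {group 'S_N}) (X : representation F H).
Hypothesis ltNK : (N < K)%N.

Lemma mxtrace_conj h y : h \in H -> y \in H -> \tr (X (h * y * h^-1)%g) = \tr (X y).
Proof.
move=> Hh Hy; rewrite !repr_mxM ?groupM ?groupV // mxtrace_mulC mulmxA.
by rewrite -repr_mxM ?groupV // mulVg repr_mx1 mul1mx.
Qed.

Lemma mxtrace_induced p : #|H|%:R * \tr (induced (subsetT H) X p)
  = \sum_(x : 'S_N) (if (x * p * x^-1)%g \in H then \tr (X (x * p * x^-1)%g) else 0).
Proof.
set phi := fun x : 'S_N => if (x * p * x^-1)%g \in H then \tr (X (x * p * x^-1)%g) else 0.
have phiM h x : h \in H -> phi (h * x)%g = phi x.
  move=> Hh; have e : (h * x * p * (h * x)^-1 = h * (x * p * x^-1) * h^-1)%g.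
    by rewrite invMg !mulgA.
  rewrite /phi e groupMr ?groupV // groupMl //; case: ifP => // Hy.
  exact: mxtrace_conj.
have -> : \tr (induced (subsetT H) X p)
    = \sum_(i < #|rcosets H [set: 'S_N]|) phi (rcoset_rep i).
  rewrite mxtrace_mxblock; apply: eq_bigr => i _ /=; rewrite /phi.
  by case: ifP => // _; rewrite linear0.
have -> : \sum_x phi x = \sum_(x in [set: 'S_N]) phi x.
  by apply: eq_bigl => x; rewrite inE.
rewrite (set_partition_big _ (rcosets_partition (subsetT H))) /=.
rewrite [RHS]big_enum_val mulr_sumr; apply: eq_bigr => i _.
have [_ ->] := rcoset_repP (subsetT H) i; rewrite (reindex_inj (mulIg (rcoset_rep i))) /=.
rewrite (eq_bigl (mem H)) => [|x]; last by rewrite mem_rcoset mulgK.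
rewrite (eq_bigr (fun=> phi (rcoset_rep i))) => [|h Hh]; last by rewrite phiM.
by rewrite sumr_const mulr_natl.
Qed.

(** The rank is a trace, expanded by the induced character formula. Substituting p = w^x, the
    condition that p preserves [c0] says that w fixes [c0] recoloured by x, and the sum over x
    becomes a sum over colourings. *)
Lemma rank_asum_induced (c0 : {ffun 'I_N -> 'I_d}) :
  #|H|%:R * (\rank (asum (induced (subsetT H) X) (cstab c0)))%:R
    = \sum_(w in H) (-1) ^+ w * \tr (X w)
        * #|[set c : {ffun 'I_N -> 'I_d} |
              (weight K c == weight K c0) && (recolour c w == c)]|%:R :> F.
Proof.
have C_neq0 : (#|cstab c0|%:R : F) != 0.
  by rewrite pnatr_eq0 -lt0n (cardG_gt0 (cstab_group c0)).
apply: (mulfI C_neq0); rewrite mulrCA -(mxtrace_asum _ (cstab_group c0)).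
rewrite /asum linear_sum mulr_sumr /=.
pose T p (x : 'S_N) := if (x * p * x^-1)%g \in H then \tr (X (x * p * x^-1)%g) else 0.
transitivity (\sum_(x : 'S_N) \sum_(p in cstab c0) (-1) ^+ p * T p x).
  rewrite exchange_big /=; apply: eq_bigr => p _.
  by rewrite linearZ /= mulrCA mxtrace_induced mulr_sumr.
transitivity (\sum_(w in H) \sum_(x : 'S_N)
    (-1) ^+ w * \tr (X w) * (recolour (recolour c0 x) w == recolour c0 x)%:R).
  rewrite [RHS]exchange_big /=; apply: eq_bigr => x _.
  rewrite (reindex_inj (conjg_inj x)) /= big_mkcond [RHS]big_mkcond /=.
  apply: eq_bigr => w _; rewrite /T.
  have -> : (x * w ^ x * x^-1 = w)%g by rewrite conjgE !mulgA mulgV mul1g mulgK.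
  rewrite odd_permJ; case: ifP; case: ifP => Hw Cw; rewrite ?mulr0 //; last first.
    case: eqP => [/ffunP e|]; last by rewrite mulr0.
    case/negP: (negbT Cw); apply/cstabP => k; rewrite conjgE !permM.
    by have := e (x^-1%g k); rewrite !ffunE permKV.
  case: eqP => [|[]]; first by rewrite mulr1.
  apply/ffunP => k; rewrite !ffunE; move/cstabP: Cw => /(_ (x k)).
  by rewrite conjgE !permM permK.
rewrite mulr_sumr; apply: eq_bigr => w _.
rewrite -mulr_sumr mulrCA; congr (_ * _).
rewrite (sum_recolour c0 (fun c => (recolour c w == c)%:R) ltNK).
congr (_ * _); rewrite -sum1_card natr_sum big_mkcond [RHS]big_mkcond /=.
by apply: eq_bigr => c _; rewrite inE; case: (weight K c == _); case: eqP.
Qed.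

End InducedRank.

(** * Wreath products *)

Section Sign.

Variables (A B : finType) (N : nat) (e : B -> A -> 'I_N).
Hypothesis e_inj : forall b a b' a', e b a = e b' a' -> (b, a) = (b', a').
Hypothesis e_onto : forall k, exists b, exists a, k = e b a.

(** Induction on the number of moved points, splitting one transposition off both sides. The array
    [e] is read by blocks or by positions in [sign_wreath_elt]. *)
Lemma odd_blockwise_perm (g : B -> {perm A}) (p : 'S_N) :
    (forall b a, p (e b a) = e b (g b a)) ->
  odd_perm p = \big[addb/false]_b odd_perm (g b).
Proof.
have [k] := ubnP #|[set x : B * A | g x.1 x.2 != x.2]|; elim: k => // k IHk in g p *.
rewrite ltnS => le_k pE.
have [/existsP[b /existsP[a nga]]|/negP no] := boolP [exists b, exists a, g b a != a].
  pose tau b' := if b' == b then tperm a (g b a) else 1%g.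
  have tauE b' x : tperm (e b a) (e b (g b a)) (e b' x) = e b' (tau b' x).
    rewrite /tau; have [->|nb] := eqVneq b' b.
      have inj_b : injective (e b) by move=> y z /e_inj[].
      by case: tpermP => [/inj_b->|/inj_b->|] /=; rewrite ?tpermL ?tpermR //
        => n1 n2; rewrite tpermD // eq_sym; apply/eqP => E; [apply: n1|apply: n2]; rewrite E.
    by rewrite perm1 tpermD //; apply/eqP => /e_inj[eb]; rewrite eb eqxx in nb.
  have neq : e b a != e b (g b a).
    by apply/eqP => /e_inj[ea]; rewrite -ea eqxx in nga.
  have := IHk (fun b' => tau b' * g b')%g (tperm (e b a) (e b (g b a)) * p)%g.
  rewrite odd_permM odd_tperm neq => IH.
  apply: (can_inj (addKb true)); rewrite IH; last 2 first.
  - apply: leq_trans le_k; apply: proper_card; apply/properP; split.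
      apply/subsetP => -[b' x]; rewrite !inE /= permM /tau.
      have [->|] := eqVneq b' b; last by rewrite perm1.
      case: tpermP => [->//|->|//]; by rewrite eqxx.
    exists (b, g b a); rewrite !inE /= ?(inj_eq perm_inj) //.
    by rewrite permM /tau eqxx tpermR eqxx.
  - by move=> b' x; rewrite [LHS]permM tauE pE -permM.
  rewrite (eq_bigr (fun b' => odd_perm (tau b') (+) odd_perm (g b'))); last first.
    by move=> b' _; rewrite odd_permM.
  suff tau_odd : \big[addb/false]_b' odd_perm (tau b') = true.
    by rewrite big_split /= tau_odd.
  rewrite (bigD1 b) //= big1 ?addbF => [|b' /negPf nb].
    by rewrite /tau eqxx odd_tperm eq_sym nga.
  by rewrite /tau nb odd_perm1.
have g1 b : g b = 1%g.
  apply/permP => a; rewrite perm1; apply/eqP/negPn/negP => nga; apply: no.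
  by apply/existsP; exists b; apply/existsP; exists a.
have -> : p = 1%g.
  by apply/permP => x; have [b [a ->]] := e_onto x; rewrite pE g1 !perm1.
by rewrite odd_perm1 big1 // => b _; rewrite g1 odd_perm1.
Qed.

End Sign.

(** * Sums and signs over the wreath product *)

Section WreathSum.

Variables (m n : nat).
Hypothesis m_gt0 : (0 < m)%N.

Definition wreath_fun (f : {ffun 'I_n -> 'S_m}) (s : 'S_n) (k : 'I_(m * n)) :
  'I_(m * n) := mxvec_index (f (letter_block k) (letter_pos k)) (s (letter_block k)).

Lemma mxvec_index_inj (j j' : 'I_m) (i i' : 'I_n) :
  mxvec_index j i = mxvec_index j' i' -> (j, i) = (j', i').
Proof. by move/(congr1 (@unletter m n)); rewrite !unletterK. Qed.

Lemma wreath_fun_inj f s : injective (wreath_fun f s).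
Proof.
move=> k l /mxvec_index_inj[ej /perm_inj ei]; rewrite -[k]letterE -[l]letterE ei.
by rewrite ei in ej; rewrite (perm_inj ej).
Qed.

Definition wreath_elt f s : 'S_(m * n) := perm (@wreath_fun_inj f s).

Lemma wreath_eltE f s j i :
  wreath_elt f s (mxvec_index j i) = mxvec_index (f i j) (s i).
Proof. by rewrite permE /wreath_fun letter_blockE letter_posE. Qed.

Lemma mem_wreath_elt f s : wreath_elt f s \in wreath m n.
Proof.
apply/wreath_setP => k l; rewrite -[k]letterE -[l]letterE !wreath_eltE.
by rewrite !letter_blockE (inj_eq perm_inj).
Qed.

Lemma wreath_elt_factor f s i : wreath_factor (wreath_elt f s) i = f i.
Proof.
apply/permP => j; rewrite -wreath_factorE ?mem_wreath_elt //.
by rewrite wreath_eltE letter_posE.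
Qed.

Lemma wreath_elt_top f s : wreath_top (wreath_elt f s) = s.
Proof.
apply/permP => i; rewrite -(wreath_topE (Ordinal m_gt0)) ?mem_wreath_elt //.
by rewrite wreath_eltE letter_blockE.
Qed.

Lemma sum_wreath (R : nmodType) (Phi : 'S_(m * n) -> R) :
  \sum_(w in wreath m n) Phi w = \sum_f \sum_s Phi (wreath_elt f s).
Proof.
rewrite pair_big /=; pose h (x : {ffun 'I_n -> 'S_m} * 'S_n) := wreath_elt x.1 x.2.
rewrite (reindex_onto h (fun w => ([ffun i => wreath_factor w i], wreath_top w))) /=.
  apply: eq_bigl => -[f s]; rewrite mem_wreath_elt /= wreath_elt_top.
  by apply/eqP; congr (_, _); apply/ffunP => i; rewrite ffunE wreath_elt_factor.
move=> w Ww; apply/permP => k; rewrite -[k]letterE wreath_eltE ffunE.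
by rewrite -wreathE.
Qed.

Lemma card_wreath : #|wreath m n| = (m`! ^ n * n`!)%N.
Proof.
rewrite -sum1_card (sum_wreath (fun=> 1%N)).
rewrite !sum_nat_const muln1 card_ffun card_ord.
by congr (_ ^ _ * _)%N; rewrite -card_Sn; apply: eq_card => x; rewrite !inE.
Qed.

(** A pure block permutation acts as [s] on the letters of each of the m positions, whence the
    exponent m. *)
Lemma sign_wreath_elt (R : pzRingType) f s :
  (-1) ^+ (wreath_elt f s) = (\prod_i (-1) ^+ (f i)) * (-1) ^+ (m * s) :> R.
Proof.
have -> : wreath_elt f s = (wreath_elt f 1 * wreath_elt [ffun=> 1] s)%g.
  apply/permP => k; rewrite -[k]letterE permM !wreath_eltE ffunE.
  by rewrite !perm1.
rewrite odd_permM signr_addb; congr (_ * _).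
  rewrite (@odd_blockwise_perm _ _ _ (fun (i : 'I_n) (j : 'I_m) => mxvec_index j i) _ _ f).
  - by elim/big_rec2: _ => [|i x y _ <-]; rewrite ?expr0 // signr_addb.
  - by move=> b a b' a' /mxvec_index_inj[-> ->].
  - by move=> k; exists (letter_block k), (letter_pos k); rewrite letterE.
  by move=> i j; rewrite wreath_eltE perm1.
rewrite (@odd_blockwise_perm _ _ _
  (fun (j : 'I_m) (i : 'I_n) => mxvec_index j i) _ _ (fun=> s)).
- have -> : (-1) ^+ (m * s) = \prod_(j < m) (-1) ^+ s :> R.
    by rewrite prodr_const card_ord -exprM mulnC.
  by elim/big_rec2: _ => [|i x y _ <-]; rewrite ?expr0 // signr_addb.
- by move=> b a b' a' /mxvec_index_inj[-> ->].
- by move=> k; exists (letter_pos k), (letter_block k); rewrite letterE.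
by move=> j i; rewrite wreath_eltE ffunE perm1.
Qed.


(** * The rank on the Foulkes module as an alternating sum *)

Section FoulkesRank.

Variables (F : numFieldType) (d K : nat).
Variables (U : representation F [set: 'S_m]) (Z : representation F [set: 'S_n]).
Hypothesis ltNK : (m * n < K)%N.
Hypothesis Z_sign : forall s : 'S_n, (-1) ^+ (m * s) * \tr (Z s) = (-1) ^+ s.

Notation word := {ffun 'I_m -> 'I_d}.
Notation index := (word * 'I_(rdegree U))%type.

(** An entry of the matrix of [g] on the words tensored with [U] and the sign. *)
Definition signed_block (g : 'S_m) (x y : index) : F :=
  (recolour y.1 g == x.1)%:R * ((-1) ^+ g * U g x.2 y.2).

(* The matrix of the projection of the tensor product of the words with       *)
(* U (x) sgn onto its invariants under S_m.                                   *)
Definition block_proj (x y : index) : F :=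
  m`!%:R^-1 * \sum_(g : 'S_m) signed_block g x y.

Definition words (c : {ffun 'I_(m * n) -> 'I_d}) : {ffun 'I_n -> word} :=
  [ffun i => [ffun j => c (mxvec_index j i)]].

Definition unwords (b : {ffun 'I_n -> word}) : {ffun 'I_(m * n) -> 'I_d} :=
  [ffun k => b (letter_block k) (letter_pos k)].

Lemma wordsK : cancel words unwords.
Proof. by move=> c; apply/ffunP => k; rewrite !ffunE letterE. Qed.

Lemma unwordsK : cancel unwords words.
Proof.
move=> b; apply/ffunP => i; apply/ffunP => j; rewrite !ffunE.
by rewrite letter_blockE letter_posE.
Qed.

Lemma sum_letters (R : nmodType) (f : 'I_(m * n) -> R) :
  \sum_k f k = \sum_(i < n) \sum_(j < m) f (mxvec_index j i).
Proof.
rewrite pair_big /= (reindex (fun x : 'I_n * 'I_m => mxvec_index x.2 x.1)) //=.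
exists (fun k => (letter_block k, letter_pos k)) => [[i j] _|k _] /=.
  by rewrite letter_blockE letter_posE.
by rewrite letterE.
Qed.

Lemma weight_words c : weight K c = (\sum_i weight K (words c i))%N.
Proof.
rewrite /weight (sum_letters (fun k => K ^ c k)%N).
by apply: eq_bigr => i _; apply: eq_bigr => j _; rewrite !ffunE.
Qed.

Lemma recolour_words c f s : (recolour c (wreath_elt f s) == c)
  = [forall i, recolour (words c (s i)) (f i) == words c i].
Proof.
apply/eqP/forallP => [e i|e].
  apply/eqP/ffunP => j; rewrite !ffunE -wreath_eltE.
  by rewrite -[in RHS]e ffunE.
apply/ffunP => k; rewrite -[k]letterE ffunE wreath_eltE.
by have /eqP/ffunP/(_ (letter_pos k)) := e (letter_block k); rewrite !ffunE.
Qed.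

Lemma mxtrace_oslash f s : \tr (oslash U Z (wreath_elt f s)) =
  (\sum_(a : {ffun 'I_n -> 'I_(rdegree U)}) \prod_i U (f i) (a i) (a (s i)))
    * \tr (Z s).
Proof.
rewrite /= mxtrace_prod wreath_elt_top; congr (_ * _).
rewrite (reindex (@enum_val _ {ffun 'I_n -> 'I_(rdegree U)})) /=; last first.
  exact/onW_bij/enum_val_bij.
apply: eq_bigr => a _; rewrite mxE; apply: eq_bigr => i _.
by rewrite wreath_elt_factor wreath_elt_top.
Qed.

(** An n-tuple of indices is a colouring of all letters together with a basis vector of the tensor
    power of [U], and the two contributions separate. *)
Lemma sum_signed_blocks v (f : {ffun 'I_n -> 'S_m}) (s : 'S_n) :
  \sum_(b : {ffun 'I_n -> index} | (\sum_i weight K (b i).1)%N == v)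
      \prod_i signed_block (f i) (b i) (b (s i))
    = #|[set c : {ffun 'I_(m * n) -> 'I_d} |
            (weight K c == v) && (recolour c (wreath_elt f s) == c)]|%:R
      * ((\prod_i (-1) ^+ (f i)) * \sum_(a : {ffun 'I_n -> 'I_(rdegree U)})
                                      \prod_i U (f i) (a i) (a (s i))).
Proof.
pose h (x : {ffun 'I_(m * n) -> 'I_d} * {ffun 'I_n -> 'I_(rdegree U)}) :=
  [ffun i => (words x.1 i, x.2 i)].
rewrite (reindex h) /=; last first.
  exists (fun b : {ffun 'I_n -> index} =>
    (unwords [ffun i => (b i).1], [ffun i => (b i).2])) => [[c a] _|b _].
    congr (_, _); last by apply/ffunP => i; rewrite !ffunE.
    by rewrite -[RHS]wordsK; congr unwords; apply/ffunP => i; rewrite !ffunE.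
  by apply/ffunP => i; rewrite ffunE unwordsK !ffunE; case: (b i).
transitivity (\sum_(c : {ffun 'I_(m * n) -> 'I_d} | weight K c == v)
  \sum_(a : {ffun 'I_n -> 'I_(rdegree U)})
    (recolour c (wreath_elt f s) == c)%:R
      * ((\prod_i (-1) ^+ (f i)) * \prod_i U (f i) (a i) (a (s i)))).
  rewrite pair_big /=; apply: eq_big => [[c a]|[c a] _] /=.
    by rewrite weight_words andbT; under eq_bigr do rewrite ffunE.
  have hE i : h (c, a) i = (words c i, a i) by rewrite ffunE.
  under eq_bigr do rewrite /signed_block !hE /=.
  rewrite !big_split /=; congr (_ * _); rewrite recolour_words.
  case: forallP => [e|ne]; first by rewrite big1 // => i _; rewrite e.
  case: (pickP (fun i => recolour (words c (s i)) (f i) != words c i)) => [i ni|all_eq].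
    by rewrite (bigD1 i) //= (negPf ni) mul0r.
  by case: ne => i; apply/negbNE; rewrite all_eq.
rewrite -sum1_card natr_sum mulr_suml [LHS]big_mkcond [RHS]big_mkcond /=.
apply: eq_bigr => c _; rewrite inE; case: (weight K c == v) => //=.
rewrite -mulr_sumr -mulr_sumr; case: (recolour _ _ == c); first by [].
by rewrite mul0r.
Qed.

(** For a fixed block permutation the sum over the base group S_m^n distributes over the blocks and
    averages each one to [block_proj]. By [Z_sign] the remaining factor is the sign of [s]. *)
Lemma rank_asum_foulkes (c0 : {ffun 'I_(m * n) -> 'I_d}) :
  n`!%:R * (\rank (asum (induced (subsetT (wreath m n)) (oslash U Z)) (cstab c0)))%:R
    = \sum_(s : 'S_n) (-1) ^+ s *
        \sum_(b : {ffun 'I_n -> index} | (\sum_i weight K (b i).1)%N == weight K c0)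
           \prod_i block_proj (b i) (b (s i)) :> F.
Proof.
have m_neq0 : (m`!%:R : F) != 0 by rewrite pnatr_eq0 -lt0n fact_gt0.
have mn_neq0 : (m`!%:R ^+ n : F) != 0 by rewrite expf_neq0.
apply: (mulfI mn_neq0); rewrite mulrA -natrX -natrM -card_wreath.
rewrite (rank_asum_induced _ ltNK) sum_wreath exchange_big mulr_sumr /=.
apply: eq_bigr => s _; rewrite mulrCA; set v := weight K c0.
transitivity (\sum_(f : {ffun 'I_n -> 'S_m}) (-1) ^+ s *
    \sum_(b : {ffun 'I_n -> index} | (\sum_i weight K (b i).1)%N == v)
      \prod_i signed_block (f i) (b i) (b (s i))).
  apply: eq_bigr => f _; rewrite sum_signed_blocks sign_wreath_elt mxtrace_oslash.
  rewrite -Z_sign; set x := \prod_i _; set y := (-1) ^+ (m * s); set S := \sum_a _.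
  set k := #|_|%:R; set z := \tr _.
  by rewrite mulrACA [LHS]mulrC [RHS]mulrCA [y * z * _]mulrC.
rewrite -mulr_sumr; congr (_ * _); rewrite exchange_big mulr_sumr /=.
apply: eq_bigr => b _.
rewrite -(bigA_distr_bigA (fun i g => signed_block g (b i) (b (s i)))).
rewrite natrX -[n in _ ^+ n]card_ord -prodr_const -big_split /=.
by apply: eq_bigr => i _; rewrite /block_proj mulrA divff ?mul1r.
Qed.

End FoulkesRank.

End WreathSum.

(** * Exterior powers of the image of a graded projection *)

Section ProjectionCount.

Variables (F : numFieldType) (I : finType) (P : I -> I -> F) (wt : I -> nat).
Hypothesis P_idem : forall x z, \sum_y P x y * P y z = P x z.
Hypothesis P_graded : forall x y, wt x != wt y -> P x y = 0.

(** As [P] respects weights, keeping its rows of weight [v] gives the projection onto the component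
    of weight [v] of its image. *)
Definition graded_part (v : nat) : 'M[F]_#|I| :=
  \matrix_(i, j) (if wt (enum_val i) == v then P (enum_val i) (enum_val j) else 0).

Definition wt_bound : nat := (\max_x wt x).+1.

Definition gbasis := {v : 'I_wt_bound & 'I_(\rank (graded_part v))}.

Definition gwt (b : gbasis) : nat := tag b.

Lemma wt_lt x : (wt x < wt_bound)%N.
Proof. by rewrite ltnS leq_bigmax. Qed.

Let sum_index (f : I -> F) : \sum_x f x = \sum_(i < #|I|) f (enum_val i).
Proof. by rewrite -big_enum_val. Qed.

Lemma graded_partM v v' : graded_part v *m graded_part v' =
  if v == v' then graded_part v else 0.
Proof.
apply/matrixP => i k; rewrite mxE.
rewrite (eq_bigr (fun j => (if (wt (enum_val i) == v) && (v == v')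
    then P (enum_val i) (enum_val j) * P (enum_val j) (enum_val k) else 0))).
  case: (eqVneq v v') => _; last by rewrite big1 ?mxE // => j; rewrite andbF.
  rewrite mxE andbT; case: eqP => _; last by rewrite big1.
  by rewrite -(sum_index (fun y => P _ y * P y _)) P_idem.
move=> j _; rewrite !mxE; have [e|_] := eqVneq (wt (enum_val i)) v; last by rewrite mul0r.
have [e'|ne] := eqVneq (wt (enum_val i)) (wt (enum_val j)).
  by rewrite -e' e /=; case: ifP; rewrite ?mulr0.
by rewrite P_graded // !mul0r; case: ifP.
Qed.

Lemma rank_graded_part v : (\rank (graded_part v))%:R = \sum_(x | wt x == v) P x x.
Proof.
rewrite -mxtrace_idempotent; last by rewrite graded_partM eqxx.
rewrite big_mkcond (sum_index (fun x => if wt x == v then P x x else 0)).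
by apply: eq_bigr => i _; rewrite mxE.
Qed.

Lemma card_gbasis v : #|[set b | gwt b == v]| = \rank (graded_part v).
Proof.
rewrite -sum1_card (eq_bigl (fun b => gwt b == v)) => [|b]; last by rewrite inE.
rewrite big_mkcond /=.
rewrite -(sig_big_dep predT (fun _ _ => true)
  (fun (u : 'I_wt_bound) (_ : 'I_(\rank (graded_part u))) =>
    if val u == v then 1%N else 0%N)) /=.
rewrite (eq_bigr (fun u : 'I_wt_bound =>
    if val u == v then \rank (graded_part v) else 0%N)) => [|u _]; last first.
  by rewrite sum_nat_const card_ord; case: eqP => [->|_]; rewrite ?muln1 ?muln0.
have [lt|le] := ltnP v wt_bound.
  rewrite (bigD1 (Ordinal lt)) //= eqxx big1 ?addn0 // => u.
  by rewrite -val_eqE /= => /negPf->.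
rewrite big1 => [|u _]; last first.
  by case: eqP => // e; rewrite -e leqNgt ltn_ord in le.
suff -> : graded_part v = 0 by rewrite mxrank0.
apply/matrixP => i j; rewrite !mxE; case: eqP => // e.
by have := wt_lt (enum_val i); rewrite e ltnNge le.
Qed.

(** [glift] and [gproj] are the factors of rank factorizations of the graded parts: the inclusion of
    the image of [P] in terms of a basis, and the coordinates in this basis. *)
Definition glift (x : I) (b : gbasis) : F :=
  col_base (graded_part (tag b)) (enum_rank x) (tagged b).
Definition gproj (b : gbasis) (x : I) : F :=
  row_base (graded_part (tag b)) (tagged b) (enum_rank x).

Lemma sum_gbasis x y : \sum_b glift x b * gproj b y = P x y.
Proof.
rewrite -(sig_big_dep predT (fun _ _ => true)
  (fun (v : 'I_wt_bound) (u : 'I_(\rank (graded_part v))) =>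
    col_base (graded_part v) (enum_rank x) u * row_base (graded_part v) u (enum_rank y))) /=.
rewrite (eq_bigr (fun v : 'I__ => graded_part v (enum_rank x) (enum_rank y))).
  rewrite (bigD1 (Ordinal (wt_lt x))) //= mxE !enum_rankK eqxx big1 ?addr0 //.
  by move=> v; rewrite -val_eqE mxE !enum_rankK eq_sym => /negPf->.
by move=> v _; rewrite -[in RHS](mulmx_base (graded_part v)) mxE.
Qed.

Lemma sum_gproj b b' : \sum_x gproj b x * glift x b' = (b == b')%:R.
Proof.
case: b b' => [v u] [v' u']; rewrite /gproj /glift /=.
rewrite sum_index; under eq_bigr do rewrite enum_valK.
have := graded_partM v v'; have [e|neq] := eqVneq v v'; last first.
  rewrite (negPf neq : (val v == val v') = false) => e0.
  rewrite (_ : (_ == _) = false); last first.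
    by apply/eqP => /(congr1 tag)/= e; rewrite e eqxx in neq.
  suff /matrixP/(_ u u') : row_base (graded_part v) *m col_base (graded_part v') = 0.
    by rewrite !mxE.
  move: (col_base_full (graded_part v)) (row_base_free (graded_part v'))
    (mulmx_base (graded_part v)) (mulmx_base (graded_part v')).
  move: (col_base (graded_part v)) (row_base (graded_part v'))
    (row_base (graded_part v)) (col_base (graded_part v')) => C R' R C' fC fR e1 e2.
  apply: (row_full_inj fC); apply: (row_free_inj fR).
  by rewrite mulmx0 mul0mx mulmxA e1 -mulmxA e2.
case: v' / e u' => u' e0; rewrite eq_Tagged /=.
suff /matrixP/(_ u u') : row_base (graded_part v) *m col_base (graded_part v) = 1%:M.
  by rewrite !mxE.
rewrite eqxx in e0; move: (col_base_full (graded_part v)) (row_base_free (graded_part v))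
    (mulmx_base (graded_part v)).
move: (col_base (graded_part v)) (row_base (graded_part v)) => C R fC fR e1.
apply: (row_full_inj fC); apply: (row_free_inj fR).
by rewrite mulmx1 mulmxA e1 -mulmxA e1.
Qed.

Lemma glift_graded x b : wt x != gwt b -> glift x b = 0.
Proof.
case: b => v u; rewrite /gwt /glift /= => neq.
have : row (enum_rank x) (graded_part v) = 0.
  by apply/rowP => j; rewrite !mxE enum_rankK (negPf neq).
move: (row_base_free (graded_part v)) (mulmx_base (graded_part v)).
move: (row_base (graded_part v)) (col_base (graded_part v)) => R C fR e1.
move=> e0; have /rowP/(_ u) : row (enum_rank x) C = 0.
  by apply: (row_free_inj fR); rewrite mul0mx -row_mul e1.
by rewrite !mxE.
Qed.

(** If two values of [u] agree, multiplication by their transposition reverses all signs; if [u] is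
    injective only the identity contributes. *)
Lemma sum_sign_fixed n (T : eqType) (u : 'I_n -> T) :
  \sum_(s : 'S_n) (-1) ^+ s * [forall i, u (s i) == u i]%:R
    = (injectiveb u)%:R :> F.
Proof.
have [/injectiveP u_inj|/injectiveP u_ninj] := boolP (injectiveb u).
  rewrite (bigD1 1%g) //= odd_perm1 mul1r big1 ?addr0 => [|s ns1].
    by case: forallP => // -[] i; rewrite perm1.
  case: forallP => [e|]; last by rewrite mulr0.
  by case/eqP: ns1; apply/permP => i; rewrite perm1; apply/u_inj/eqP.
have [k [l [neq ekl]]] : exists k l, k != l /\ u k = u l.
  apply: NNPP => no; apply: u_ninj => k l e; apply/eqP/negPn/negP => neq.
  by apply: no; exists k, l.
set S := \sum_s _; have : S = - S.
  rewrite {1}/S (reindex_inj (mulIg (tperm k l))) /= -sumrN.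
  apply: eq_bigr => s _; rewrite odd_permM odd_tperm neq signr_addb expr1 mulrN1 mulNr.
  congr (- (_ * (nat_of_bool _)%:R)); apply: eq_forallb => i; rewrite permM.
  by case: tpermP => // ->; rewrite ekl.
by move/eqP; rewrite -addr_eq0 -mulr2n mulrn_eq0 => /eqP.
Qed.

Lemma sum_injective_image n (B : finType) (Q : pred {set B}) :
  #|[set u : {ffun 'I_n -> B} | injectiveb u && Q (u @: 'I_n)]|
    = (n`! * #|[set S : {set B} | (#|S| == n) && Q S]|)%N.
Proof.
rewrite -sum1_card (partition_big (fun u : {ffun 'I_n -> B} => u @: 'I_n)
  (fun S => (#|S| == n) && Q S)) /=; last first.
  move=> u; rewrite inE => /andP[/injectiveP u_inj ->].
  by rewrite card_imset // card_ord eqxx.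
rewrite mulnC -sum1_card big_distrl /=; apply: eq_big => [S|S /andP[/eqP cS QS]].
  by rewrite inE.
have -> : n`! = #|[set f : {ffun 'I_n -> B} in ffun_on (mem S) | injectiveb f]|.
  by rewrite card_inj_ffuns_on cS card_ord ffactnn.
rewrite sum1_card mul1n; apply: eq_card => u; rewrite !inE.
rewrite unfold_in /= !inE.
apply/andP/andP => [[/andP[u_inj _] /eqP e]|[/ffun_onP uS u_inj]].
  by split=> //; apply/ffun_onP => i; rewrite -[in S]e imset_f.
have e : u @: 'I_n = S.
  apply/eqP; rewrite eqEcard cS card_imset ?card_ord ?leqnn ?andbT; last exact/injectiveP.
  by apply/subsetP => _ /imsetP[i _ ->].
by rewrite u_inj e eqxx QS.
Qed.

Lemma prodr_boolr (J : finType) (b : pred J) : \prod_j (b j)%:R = [forall j, b j]%:R :> F.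
Proof.
case: forallP => [bT|nb]; first by rewrite big1 // => j _; rewrite bT.
case: (pickP (predC b)) => [j /= /negPf bj|all_b]; first by rewrite (bigD1 j) //= bj mul0r.
by case: nb => j; have /negbFE := all_b j.
Qed.

(** Both sides are the trace of a permutation of the factors on the weight [V] part of a tensor
    power of the image of [P]; on the right the basis [gbasis] is merely permuted. *)
Lemma sum_prod_proj n V (s : 'S_n) :
  \sum_(b : {ffun 'I_n -> I} | (\sum_i wt (b i))%N == V) \prod_i P (b i) (b (s i))
    = \sum_(u : {ffun 'I_n -> gbasis} | (\sum_i gwt (u i))%N == V)
        [forall i, u (s i) == u i]%:R.
Proof.
pose T (b : {ffun 'I_n -> I}) (u : {ffun 'I_n -> gbasis}) :=
  \prod_i (glift (b i) (u i) * gproj (u i) (b (s i))).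
have T_graded (b : {ffun 'I_n -> I}) (u : {ffun 'I_n -> gbasis}) :
    (\sum_i wt (b i) = \sum_i gwt (u i))%N \/ T b u = 0.
  case: (pickP (fun i => wt (b i) != gwt (u i))) => [i neq|all_eq].
    by right; rewrite /T (bigD1 i) //= glift_graded // !mul0r.
  by left; apply: eq_bigr => i _; apply/eqP/negbNE; rewrite all_eq.
transitivity (\sum_(b : {ffun 'I_n -> I}) \sum_(u : {ffun 'I_n -> gbasis})
      (if (\sum_i gwt (u i))%N == V then T b u else 0)).
  rewrite big_mkcond /=; apply: eq_bigr => b _.
  under [X in if _ then X else _]eq_bigr do rewrite -sum_gbasis.
  rewrite bigA_distr_bigA /=; case: eqP => [e|ne].
    apply: eq_bigr => u _; have [eq_wt|T0] := T_graded b u.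
      by rewrite -eq_wt e eqxx.
    by rewrite -/(T b u) T0; case: ifP.
  rewrite big1 // => u _; have [eq_wt|T0] := T_graded b u; last by rewrite T0; case: ifP.
  by rewrite -eq_wt; case: eqP.
rewrite exchange_big [RHS]big_mkcond /=; apply: eq_bigr => u _.
case: eqP => _; last by rewrite big1.
transitivity (\prod_i ((u (s^-1%g i) == u i)%:R : F)).
  under [RHS]eq_bigr do rewrite -sum_gproj.
  rewrite bigA_distr_bigA /=; apply: eq_bigr => b _; rewrite /T !big_split /= mulrC.
  congr (_ * _); rewrite (reindex_inj (@perm_inj _ s^-1%g)) /=.
  by apply: eq_bigr => i _; rewrite permKV.
rewrite (prodr_boolr (fun i => u (s^-1%g i) == u i)).
congr (nat_of_bool _)%:R; apply/forallP/forallP => h i.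
  by have := h (s i); rewrite permK eq_sym.
by have := h (s^-1%g i); rewrite permKV eq_sym.
Qed.

(** The alternating sum of these traces is n! times the dimension of the weight [V] part of the
    exterior power, whose basis is given by n-subsets. *)
Lemma sum_sign_prod n V :
  \sum_(s : 'S_n) (-1) ^+ s *
     \sum_(b : {ffun 'I_n -> I} | (\sum_i wt (b i))%N == V) \prod_i P (b i) (b (s i))
    = (n`! * #|[set S : {set gbasis} | (#|S| == n) && (\sum_(b in S) gwt b == V)%N]|)%:R.
Proof.
under eq_bigr do rewrite sum_prod_proj mulr_sumr.
rewrite exchange_big /=.
under eq_bigr do rewrite sum_sign_fixed.
rewrite -(sum_injective_image n (fun S => \sum_(b in S) gwt b == V)%N).
rewrite -[in RHS]sum1_card natr_sum.
rewrite big_mkcond [RHS]big_mkcond /=; apply: eq_bigr => u _; rewrite inE.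
case: injectiveP => [u_inj|_]; last by case: ifP.
rewrite big_imset //=; last by move=> i j _ _; apply: u_inj.
Qed.

End ProjectionCount.

(** * The graded basis of the invariants of words *)

Section BlockProjection.

Variables (F : numFieldType) (m d K : nat) (U : representation F [set: 'S_m]).
Hypothesis ltmK : (m < K)%N.

Notation word := {ffun 'I_m -> 'I_d}.
Notation index := (word * 'I_(rdegree U))%type.
Notation P := (@block_proj m F d U).
Notation sb := (@signed_block m F d U).

Let card_perms : #|{: 'S_m}| = m`!.
Proof. by rewrite -card_Sn; apply: eq_card => g; rewrite !inE. Qed.

Lemma signed_blockM g h (x z : index) : \sum_y sb g x y * sb h y z = sb (g * h)%g x z.
Proof.
rewrite -(pair_big predT predT (fun c a => sb g x (c, a) * sb h (c, a) z)) /=.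
rewrite (bigD1 (recolour z.1 h)) //= [X in _ + X]big1 ?addr0 => [|c nc]; last first.
  rewrite big1 // => a _; rewrite /signed_block /= [recolour _ h == c]eq_sym.
  by rewrite (negPf nc) mul0r mulr0.
have e : recolour (recolour z.1 h) g = recolour z.1 (g * h)%g.
  by apply/ffunP => k; rewrite !ffunE permM.
rewrite /signed_block /= eqxx e repr_mxM ?inE // mxE odd_permM signr_addb.
by rewrite !mulr_sumr; apply: eq_bigr => a _; rewrite mul1r -[LHS]mulrA mulrACA.
Qed.

Lemma block_proj_idem (x z : index) : \sum_y P x y * P y z = P x z.
Proof.
have m_neq0 : (m`!%:R : F) != 0 by rewrite pnatr_eq0 -lt0n fact_gt0.
rewrite /block_proj.
transitivity (\sum_y m`!%:R^-1 * (m`!%:R^-1 * \sum_g \sum_h sb g x y * sb h y z)).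
  apply: eq_bigr => y _; rewrite mulrACA -mulrA; congr (_ * (_ * _)).
  by rewrite big_distrlr.
rewrite -!mulr_sumr exchange_big /=; congr (_ * _).
under eq_bigr => g _ do [rewrite exchange_big /=; under eq_bigr do rewrite signed_blockM].
under eq_bigr => g _ do rewrite -(reindex_inj (mulgI g) (P := predT) (F := fun h => sb h x z)).
by rewrite sumr_const card_perms -[X in _ * X]mulr_natl mulrA mulVf ?mul1r.
Qed.

Lemma block_proj_graded (x y : index) :
  weight K x.1 != weight K y.1 -> P x y = 0.
Proof.
move=> neq; rewrite /block_proj big1 ?mulr0 // => g _; rewrite /signed_block.
case: eqP => [e|]; last by rewrite mul0r.
by rewrite -e weight_recolour eqxx in neq.
Qed.

Lemma cstab_recolour (c : word) x : cstab (recolour c x) = cstab c :^ x^-1%g.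
Proof.
apply/setP => p; rewrite mem_conjg invgK; apply/cstabP/cstabP => h k.
  by have := h (x^-1%g k); rewrite conjgE !ffunE !permM permKV.
by have := h (x k); rewrite conjgE !ffunE !permM permK.
Qed.

Lemma rank_asumJ A x : \rank (asum U (A :^ x)) = \rank (asum U A).
Proof.
suff -> : asum U (A :^ x) = U x^-1%g *m asum U A *m U x.
  have free y : row_free (U y) by rewrite repr_mx_free ?inE.
  rewrite mxrankMfree // eqmxMfull //.
  by rewrite row_full_unit -row_free_unit.
rewrite /asum mulmx_sumr mulmx_suml (reindex_inj (conjg_inj x)) /=.
apply: eq_big => p; first by rewrite memJ_conjg.
by move=> _; rewrite odd_permJ -scalemxAr -scalemxAl conjgE !repr_mxM ?inE // mulmxA.
Qed.

Lemma sum_block_proj_diag v :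
  \sum_(x : index | weight K x.1 == v) P x x
    = m`!%:R^-1 * \sum_(c : word | weight K c == v)
        (#|cstab c| * \rank (asum U (cstab c)))%:R.
Proof.
transitivity (\sum_(c : word | weight K c == v) \sum_a P (c, a) (c, a)).
  by rewrite pair_big /=; apply: eq_big => [[c a]|[c a] _] //=; rewrite andbT.
rewrite mulr_sumr; apply: eq_bigr => c _; rewrite natrM.
rewrite -(mxtrace_asum _ (cstab_group c)) /block_proj -mulr_sumr exchange_big /=.
congr (_ * _); rewrite /asum linear_sum [RHS]big_mkcond /=; apply: eq_bigr => g _.
rewrite /signed_block /= -mulr_sumr -mulr_sumr linearZ /=.
have -> : (recolour c g == c) = (g \in cstab c).
  apply/eqP/cstabP => [/ffunP e k|e]; first by have := e k; rewrite ffunE.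
  by apply/ffunP => k; rewrite ffunE.
by case: ifP; rewrite ?mul1r ?mul0r.
Qed.

(** The words of this weight form one orbit, so, as in Frobenius reciprocity, the invariants of this
    weight correspond to the vectors of [U] on which the stabilizer of [c] acts by the sign. *)
Lemma rank_graded_word (c : word) :
  \rank (graded_part P (fun x => weight K x.1) (weight K c)) = \rank (asum U (cstab c)).
Proof.
have m_neq0 : (m`!%:R : F) != 0 by rewrite pnatr_eq0 -lt0n fact_gt0.
have C_neq0 : (#|cstab c|%:R : F) != 0.
  by rewrite pnatr_eq0 -lt0n (cardG_gt0 (cstab_group c)).
apply/eqP; rewrite -(eqr_nat F); apply/eqP.
rewrite (rank_graded_part block_proj_idem) //; last exact: block_proj_graded.
rewrite sum_block_proj_diag; apply: (mulfI C_neq0); rewrite mulrCA.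
rewrite -(sum_recolour c (fun c' => (#|cstab c'| * \rank (asum U (cstab c')))%:R) ltmK).
under eq_bigr do rewrite cstab_recolour rank_asumJ cardJg.
by rewrite sumr_const card_perms -[X in _ * X]mulr_natl mulrA mulVf ?mul1r // natrM.
Qed.

Lemma rank_graded_nonword v : (forall c : word, weight K c != v) ->
  \rank (graded_part P (fun x => weight K x.1) v) = 0%N.
Proof.
move=> no; apply/eqP; rewrite -(pnatr_eq0 F).
rewrite (rank_graded_part block_proj_idem); last exact: block_proj_graded.
by rewrite big_pred0 // => x; apply: negPf.
Qed.

End BlockProjection.

Lemma rank_asum_foulkes_count (F : numFieldType) (m n d K : nat)
    (U : representation F [set: 'S_m]) (Z : representation F [set: 'S_n])
    (c0 : {ffun 'I_(m * n) -> 'I_d}) :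
    (0 < m)%N -> (m * n < K)%N ->
    (forall s : 'S_n, (-1) ^+ (m * s) * \tr (Z s) = (-1) ^+ s) ->
  \rank (asum (induced (subsetT (wreath m n)) (oslash U Z)) (cstab c0))
    = #|[set S : {set gbasis (@block_proj m F d U) (fun x => weight K x.1)} |
         (#|S| == n) && (\sum_(b in S) gwt b == weight K c0)%N]|.
Proof.
move=> m_gt0 ltNK Z_sign; apply/eqP; rewrite -(eqr_nat F); apply/eqP.
have n_neq0 : (n`!%:R : F) != 0 by rewrite pnatr_eq0 -lt0n fact_gt0.
apply: (mulfI n_neq0); rewrite (rank_asum_foulkes m_gt0 U ltNK Z_sign) -natrM.
rewrite -sum_sign_prod //; first exact: block_proj_idem.
exact: block_proj_graded.
Qed.

(** * Lightest subsets and weights of partitions *)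

Section LightestSubsets.

Local Open Scope nat_scope.

Variables (B : finType) (w : B -> nat).

Definition lighter v : {set B} := [set b | w b < v].
Definition level v : {set B} := [set b | w b == v].

Lemma threshold n : 0 < n -> n <= #|B| ->
  exists v e, n = #|lighter v| + e /\ 0 < e <= #|level v|.
Proof.
(* The threshold is the least [v] for which at least [n] elements have weight at most [v]. *)
move=> n_gt0 le_n; pose le_v v := #|[set b | w b <= v]|.
have ex_v : exists v, n <= le_v v.
  exists (\max_b w b); rewrite /le_v (_ : [set _ | _] = setT) ?cardsT //.
  by apply/setP => b; rewrite !inE leq_bigmax.
case: (ex_minnP ex_v) => v le_nv min_v.
have lt_n : #|lighter v| < n.
  case: v le_nv min_v => [|v] _ min_v.
    by rewrite (_ : lighter 0 = set0) ?cards0 //; apply/setP => b; rewrite !inE.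
  rewrite ltnNge; apply/negP => le; have := min_v v; rewrite ltnn => h.
  by have := h (leq_trans le (leqnn _)).
exists v, (n - #|lighter v|); split; first by rewrite subnKC // ltnW.
rewrite subn_gt0 lt_n leq_subLR (leq_trans le_nv) // /le_v.
rewrite -cardsUI (_ : lighter v :&: level v = set0) ?cards0 ?addn0; last first.
  by apply/setP => b; rewrite !inE; case: ltngtP.
by apply: subset_leq_card; apply/subsetP => b; rewrite !inE leq_eqVlt orbC.
Qed.

Variables (v e : nat).

Let n := #|lighter v| + e.
Let L := lighter v.

Definition min_weight : nat := \sum_(b in L) w b + v * e.

(* Trading the light elements missing from S against its other elements.      *)
Lemma min_weight_split (S : {set B}) : #|S| = n ->
  min_weight + \sum_(b in L :\: S) (v - w b) + \sum_(b in S :\: L) (w b - v)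
    = \sum_(b in S) w b.
Proof.
move=> cS.
have eL : \sum_(b in L) w b + \sum_(b in L :\: S) (v - w b)
    = \sum_(b in S :&: L) w b + v * #|L :\: S|.
  rewrite (big_setID S) /= -addnA -big_split /= setIC; congr (_ + _).
  rewrite mulnC -sum_nat_const; apply: eq_bigr => b.
  by rewrite !inE => /andP[_ lt]; rewrite subnKC // ltnW.
have eS : v * #|S :\: L| + \sum_(b in S :\: L) (w b - v) = \sum_(b in S :\: L) w b.
  rewrite mulnC -sum_nat_const -big_split /=; apply: eq_bigr => b.
  by rewrite !inE -leqNgt => /andP[le _]; rewrite subnKC.
have eC : #|S :\: L| = #|L :\: S| + e.
  apply/eqP; rewrite -(eqn_add2l #|S :&: L|) cardsID addnA {1}setIC cardsID cS.
  by [].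
rewrite [RHS](big_setID L) /= -eS eC mulnDr /min_weight.
by rewrite [_ + v * e + _]addnAC eL !addnA.
Qed.

Lemma min_weight_leq (S : {set B}) : #|S| = n -> min_weight <= \sum_(b in S) w b.
Proof. by move/min_weight_split <-; rewrite -addnA leq_addr. Qed.

(** By [min_weight_split] the minimum is attained exactly when both correction sums vanish: the set
    contains all lighter elements, and its other elements have weight [v]. *)
Lemma card_min_weight :
  #|[set S : {set B} | (#|S| == n) && (\sum_(b in S) w b == min_weight)]|
    = 'C(#|level v|, e).
Proof.
have disj (T : {set B}) : T \subset level v -> L :&: T = set0.
  move=> /subsetP sT; apply/setP => b; rewrite !inE; apply/negP => /andP[lt /sT].
  by rewrite inE ltn_eqF.
rewrite -cards_draws -[RHS](card_in_imset (f := fun T => L :|: T)); last first.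
  move=> T T'; rewrite inE => /andP[sT _]; rewrite inE => /andP[sT' _] /setP eTT'.
  have dT := disj T sT; have dT' := disj T' sT'.
  apply/setP => b; have := eTT' b; rewrite !inE.
  have /setP/(_ b) := dT; have /setP/(_ b) := dT'; rewrite !inE.
  by case: (w b < v) => //= -> ->.
apply: eq_card => S; rewrite inE; apply/andP/imsetP => [[/eqP cS /eqP wS]|[T]].
  have := min_weight_split cS; rewrite wS -addnA => /eqP.
  rewrite -[X in _ == X]addn0 eqn_add2l addn_eq0 !sum_nat_eq0.
  move=> /andP[/forall_inP hL /forall_inP hS].
  have sLS : L \subset S.
    rewrite -setD_eq0; apply/eqP/setP => b; rewrite in_set0; apply/negP => Lb.
    have := hL b Lb; rewrite subn_eq0 leqNgt.
    by move: Lb; rewrite !inE => /andP[_ ->].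
  exists (S :\: L); last by rewrite -[LHS](setID S L) (setIidPr sLS).
  rewrite inE; apply/andP; split.
    apply/subsetP => b Sb; have := hS b Sb; rewrite subn_eq0 => le.
    by move: Sb; rewrite !inE -leqNgt eqn_leq => /andP[-> _]; rewrite le.
  by rewrite cardsD (setIidPr sLS) cS /n addKn.
rewrite inE => /andP[sT /eqP cT] ->; have dT := disj T sT.
have cU : #|L :|: T| = n by have := cardsUI L T; rewrite dT cards0 addn0 cT.
split; apply/eqP => //; rewrite (big_setID L) /= setUK setDUl setDv set0U.
rewrite (_ : T :\: L = T); last by apply/setDidPl; rewrite -setI_eq0 setIC dT.
rewrite /min_weight; congr (_ + _); rewrite mulnC -cT -sum_nat_const.
by apply: eq_bigr => b /(subsetP sT); rewrite inE => /eqP.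
Qed.

End LightestSubsets.

(** * Weights of column colourings and the lexicographic order *)

Section PartitionWeights.

Local Open Scope nat_scope.

Variable K : nat.
Hypothesis K_gt0 : 0 < K.

(** The weight of a row of [x] boxes coloured by their columns. *)
Definition row_weight x := \sum_(j < x) K ^ j.
Definition part_weight (la : seq nat) := \sum_(x <- la) row_weight x.

Lemma part_weight_bound (la : seq nat) x : (forall y, y \in la -> y <= x.+1) ->
  part_weight la <= sumn la * K ^ x.
Proof.
elim: la => [|y la IHla] h; rewrite /part_weight ?big_nil // big_cons /= mulnDl.
apply: leq_add; last by apply: IHla => z z_in; apply: h; rewrite inE z_in orbT.
have := h y (mem_head _ _); rewrite /row_weight => le_y.
rewrite -[y in y * _]card_ord -sum_nat_const; apply: leq_sum => j _.
by rewrite leq_pexp2l // -ltnS (leq_trans _ le_y).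
Qed.

(** If the first differing part were larger in [la], with value y in [ka], it would contribute K^y,
    whereas the rest of [ka] has fewer than K boxes, each of weight at most K^(y-1). *)
Lemma lexi_of_part_weight (la ka : seq nat) :
    0 \notin la -> 0 \notin ka -> sorted geq ka -> sumn ka < K ->
  part_weight la <= part_weight ka -> ((la : seqlexi nat) <= (ka : seqlexi nat))%O.
Proof.
have geq_trans : transitive geq by move=> a b c /= ba ac; apply: leq_trans ac ba.
elim: la ka => [|x la IHla] [|y ka] //.
  rewrite /part_weight big_nil big_cons inE negb_or eq_sym => /andP[+ _] _ _ _.
  by case: x => // x _; rewrite leqn0 addn_eq0 /row_weight big_ord_recl.
rewrite !inE !negb_or => /andP[nx nla] /andP[ny nka] s_ka lt_K.
rewrite /part_weight !big_cons -/(part_weight la) -/(part_weight ka) => le_w.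
rewrite lexi_cons !leEnat; case: (ltngtP x y) => //= [lt_yx|exy].
  case: y => [|z] in ny s_ka lt_K le_w lt_yx *; first by rewrite eqxx in ny.
  have ub : part_weight (z.+1 :: ka) <= sumn (z.+1 :: ka) * K ^ z.
    apply: part_weight_bound => u; rewrite inE => /predU1P[->//|u_ka].
    by have /allP/(_ u u_ka) := order_path_min geq_trans s_ka.
  have lb : K ^ z.+1 <= row_weight x.
    by rewrite /row_weight (bigD1 (Ordinal lt_yx)) //= leq_addr.
  have : sumn (z.+1 :: ka) * K ^ z < K ^ z.+1.
    by rewrite expnS ltn_pmul2r // expn_gt0 K_gt0.
  rewrite ltnNge => /negP; case; apply: leq_trans lb _; apply: leq_trans ub.
  by rewrite /part_weight big_cons; apply: leq_trans le_w; apply: leq_addr.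
move: le_w; rewrite exy leq_add2l; apply: IHla => //; first exact: path_sorted s_ka.
exact: leq_ltn_trans (leq_addl _ _) lt_K.
Qed.

Lemma sum_col_weight N la (t : 'S_N) : is_partition N la ->
  \sum_(k < N) K ^ col_of la t k = part_weight la.
Proof.
move=> la_part; transitivity (\sum_(k < N) K ^ reshape_offset la k).
  by rewrite [RHS](reindex_inj (@perm_inj _ t^-1%g)).
rewrite -(sumn_part la_part) /part_weight.
elim: la {la_part} => [|x la IHla]; first by rewrite big_ord0 big_nil.
rewrite big_cons -IHla big_split_ord /=; congr (_ + _); apply: eq_bigr => i _.
  by rewrite /reshape_offset /reshape_index /= subn_eq0 ltn_ord /= subn0.
congr (K ^ _); rewrite /reshape_offset /reshape_index /= subn_eq0.
by rewrite ltnNge leq_addr /= subnDA -addnS addKn addKn.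
Qed.

(** Within each row the colours are distinct, so sorting sends every letter to a column not
    exceeding its colour. *)
Lemma part_weight_leq N ka (u : 'S_N) (c : 'I_N -> nat) : is_partition N ka ->
    (forall k l, row_of ka u k = row_of ka u l -> c k = c l -> k = l) ->
  part_weight ka <= \sum_k K ^ c k.
Proof.
move=> ka_part inj_c; have [|p le_p] := @sort_rows _ _ ka_part u c.
  by move=> k l ec er; apply: inj_c.
rewrite -(sum_col_weight u ka_part).
rewrite (reindex_inj (@perm_inj _ p)) /=.
by apply: leq_sum => k _; rewrite leq_pexp2l.
Qed.

End PartitionWeights.

(** * The minimal constituent *)

Section MinimalConstituent.

Variables (F : numFieldType) (m : nat).
Hypothesis m_gt1 : (1 < m)%N.

Let m_gt0 : (0 < m)%N := ltnW m_gt1.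

Notation U := (specht F m [:: m.-1; 1%N]).

Section FixedColours.

Variable d : nat.
Hypothesis le_md : (m <= d)%N.

Notation K := d.+1.
Notation word := {ffun 'I_m -> 'I_d}.

Definition word_basis : finType :=
  gbasis (@block_proj m F d U) (fun x => weight K x.1).
Definition word_weight : word_basis -> nat := @gwt _ _ _ _.

Lemma card_level_word (c : word) :
  #|level word_weight (weight K c)| = \rank (asum U (cstab c)).
Proof. by rewrite card_gbasis rank_graded_word. Qed.

Lemma word_of_basis b : exists c : word, weight K c = word_weight b.
Proof.
apply: NNPP => no; case: b no => v u no; have := leq_ltn_trans (leq0n _) (ltn_ord u).
rewrite rank_graded_nonword // => c; apply/eqP => e; apply: no; exists c.
exact: e.
Qed.

Lemma card_level_injective (c : word) : injective c ->
  #|level word_weight (weight K c)| = m.-1.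
Proof. by move=> c_inj; rewrite card_level_word rank_asum_standard. Qed.

Lemma card_level_leq v :
  #|level word_weight v| = m.-1 \/ (#|level word_weight v| <= 1)%N.
Proof.
have [[c <-]|no] := classic (exists c : word, weight K c = v).
  have [c_inj|c_ninj] := classic (injective c); first by left; apply: card_level_injective.
  by right; rewrite card_level_word rank_asum_standard_leq1.
right; rewrite (_ : level _ _ = set0) ?cards0 //; apply/setP => b; rewrite !inE.
by apply/eqP => e; have [c ec] := word_of_basis b; apply: no; exists c; rewrite ec.
Qed.

Lemma card_word_basis n : (m * n <= d)%N -> (0 < n)%N -> (n <= #|word_basis|)%N.
Proof.
move=> le_mn n_gt0.
have lt_d (i : 'I_n) : (m.-1 + i < d)%N.
  apply: leq_trans le_mn; rewrite -ltnS -addSn prednK //.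
  by case: (m) m_gt1 (n) i => [|[|k]] // _ [|n'] [i /= lt_i] //; nia.
have lt_md (k : 'I_m) : (k < d)%N := leq_trans (ltn_ord k) le_md.
(* Words with distinct colours: 0, ..., m-2 and one further colour m-1+i. The last colour makes
   their weights distinct, so each supplies a new basis element. *)
pose c (i : 'I_n) : word :=
  [ffun k : 'I_m => if (k < m.-1)%N then Ordinal (lt_md k) else Ordinal (lt_d i)].
have cE i k : val (c i k) = if (k < m.-1)%N then val k else (m.-1 + i)%N.
  by rewrite ffunE; case: ifP.
have c_inj i : injective (c i).
  move=> k l /(congr1 val); rewrite !cE => e; apply: val_inj; move: e.
  have := ltn_ord k; have := ltn_ord l.
  by case: (ltnP k m.-1); case: (ltnP l m.-1) => /=; lia.
have /fin_all_exists[f fP] i : exists b : word_basis, word_weight b = weight K (c i).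
  have : (0 < #|level word_weight (weight K (c i))|)%N.
    by rewrite card_level_injective // -ltnS prednK.
  by case/card_gt0P => b; rewrite inE => /eqP; exists b.
have lst_lt : (m.-1 < m)%N by rewrite prednK.
have f_inj : injective f.
  move=> i j e; have := fP j; rewrite -e fP /weight.
  rewrite (bigD1 (Ordinal lst_lt)) //= [RHS](bigD1 (Ordinal lst_lt)) //= !cE /= ltnn.
  rewrite (eq_bigr (fun k : 'I_m => (K ^ c j k)%N)) => [|k nk].
    move/addIn/eqP; rewrite eqn_exp2l ?eqn_add2l ?ltnS ?(leq_trans m_gt0) //.
    by move=> /eqP/val_inj.
  by rewrite !cE ltn_neqAle nk -ltnS (prednK m_gt0) ltn_ord.
by have := leq_card f f_inj; rewrite card_ord.
Qed.

(** * The lightest subsets determine the minimal constituent *)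

Section Foulkes.

Variables (n : nat) (Z : representation F [set: 'S_n]).
Hypothesis n_gt0 : (0 < n)%N.
Hypothesis le_mnd : (m * n <= d)%N.
Hypothesis Z_sign : forall s : 'S_n, (-1) ^+ (m * s) * \tr (Z s) = (-1) ^+ s.

Notation H := (induced (subsetT (wreath m n)) (oslash U Z)).

Let rankE (c : {ffun 'I_(m * n) -> 'I_d}) : \rank (asum H (cstab c))
    = #|[set S : {set word_basis} |
         (#|S| == n) && (\sum_(b in S) word_weight b == weight K c)%N]|.
Proof. exact: rank_asum_foulkes_count. Qed.

Let part_colouring ka : is_partition (m * n) ka ->
  exists2 c : {ffun 'I_(m * n) -> 'I_d},
    weight K c = part_weight K ka & cstab c = col_stab ka 1.
Proof.
move=> ka_part; have lt (k : 'I_(m * n)) : (col_of ka 1 k < d)%N.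
  have nth_le : forall (s : seq nat) r, (nth 0 s r <= sumn s)%N.
    elim=> [|x s IHs] [|r] //=; first exact: leq_addr.
    exact: leq_trans (IHs r) (leq_addl _ _).
  apply: leq_trans (col_of_lt ka_part _ _) (leq_trans (nth_le _ _) _).
  by rewrite (sumn_part ka_part).
exists [ffun k => Ordinal (lt k)].
  by rewrite -(sum_col_weight K 1 ka_part); apply: eq_bigr => k _; rewrite ffunE.
by apply/setP => p; apply/cstabP/cstabP => e k; have := e k; rewrite !ffunE;
  [move/(congr1 val) | move=> ek; apply: val_inj].
Qed.

Let colouring_ex (S : {set word_basis}) : #|S| = n ->
  exists c : {ffun 'I_(m * n) -> 'I_d},
    weight K c = (\sum_(b in S) word_weight b)%N.
Proof.
move=> cS; have [f fE] : exists f : 'I_n -> word_basis,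
    (\sum_(b in S) word_weight b = \sum_i word_weight (f i))%N.
  by rewrite -cS; exists enum_val; rewrite big_enum_val.
have /fin_all_exists[x xP] i := word_of_basis (f i).
exists (unwords [ffun i => x i]); rewrite weight_words unwordsK fE.
by apply: eq_bigr => i _; rewrite ffunE xP.
Qed.

(** The least weight of a colouring with nonzero signed sum is that of the lightest n-subsets. It is
    attained by the columns of some constituent, which is then minimal because weights compare
    partitions. *)
Lemma foulkes_lex_min v e :
    n = (#|lighter word_weight v| + e)%N -> (0 < e <= #|level word_weight v|)%N ->
  exists2 la, is_lex_min_constituent H la &
    has_multiplicity (specht F (m * n) la) H 'C(#|level word_weight v|, e).
Proof.
move=> en /andP[e_gt0 le_e]; pose V0 := min_weight word_weight v e.
have V0_min (c : {ffun 'I_(m * n) -> 'I_d}) :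
      asum H (cstab c) != 0 -> (V0 <= weight K c)%N.
  rewrite -mxrank_eq0 -lt0n rankE => /card_gt0P[S]; rewrite inE.
  by case/andP => /eqP cS /eqP <-; apply: min_weight_leq; rewrite cS.
have rankV0 (c : {ffun 'I_(m * n) -> 'I_d}) : weight K c = V0 ->
    \rank (asum H (cstab c)) = 'C(#|level word_weight v|, e).
  by move=> wc; rewrite rankE wc -(card_min_weight word_weight v e) -en.
have part_min ka : is_partition (m * n) ka -> asum H (col_stab ka 1) != 0 ->
    (V0 <= part_weight K ka)%N.
  by move=> /part_colouring[c <- <-]; apply: V0_min.
have [c0 wc0] : exists c : {ffun 'I_(m * n) -> 'I_d}, weight K c = V0.
  have : (0 < 'C(#|level word_weight v|, e))%N by rewrite bin_gt0.
  rewrite -(card_min_weight word_weight v e) => /card_gt0P[S]; rewrite inE -en.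
  by case/andP => /eqP /colouring_ex[c wc] /eqP wS; exists c; rewrite wc wS.
have nz0 : asum H (cstab c0) != 0.
  by rewrite -mxrank_eq0 rankV0 // -lt0n bin_gt0.
have [la la_part [sum_la nz_la]] := specht_summand_of_asum nz0.
have {}nz_la : asum (tabloid_repr F (m * n) la) (cstab c0) != 0.
  apply: contraNneq nz_la => e0.
  by rewrite -mxrank_eq0 rank_asum_submod e0 mulmx0 mxrank0.
(* The rows of some tableau of shape [la] have distinct colours under [c0], which bounds the weight
   above; conversely [la] labels a constituent, so its column colouring has weight at least [V0]. *)
have wla : part_weight K la = V0.
  apply/eqP; rewrite eqn_leq; apply/andP; split.
    rewrite -wc0; have [u hu] := asum_tabloid_neq0 nz_la.
    apply: (@part_weight_leq K _ _ _ u (fun k => c0 k)) => // k l er ec.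
    by apply: hu => //; apply: val_inj.
  apply: part_min => //; rewrite -mxrank_eq0 -lt0n.
  by apply: leq_trans (rank_asum_summand _ sum_la); rewrite rank_asum_specht.
have [c wc stab_c] := part_colouring la_part.
have rk : \rank (asum H (col_stab la 1)) = 'C(#|level word_weight v|, e).
  by rewrite -stab_c rankV0 // wc.
have [] := @lex_min_multiplicity F _ H la la_part; last by rewrite rk; exists la.
  by rewrite -mxrank_eq0 rk -lt0n bin_gt0.
move=> ka ka_part nz_ka; apply: (@lexi_of_part_weight K) => //.
- by case/and3P: la_part.
- by case/and3P: ka_part.
- by case/and3P: ka_part.
- by rewrite (sumn_part ka_part) ltnS.
by rewrite wla; apply: part_min.
Qed.

End Foulkes.

End FixedColours.

End MinimalConstituent.

(** * The sign condition on nu and a bound independent of the number of colours *)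

Lemma foulkes_sign (F : numFieldType) m n (s : 'S_n) : (0 < n)%N ->
  (-1) ^+ (m * s) * \tr (specht F n (if odd m then [:: n] else nseq n 1%N) s)
    = (-1) ^+ s.
Proof.
move=> n_gt0; rewrite -signr_odd oddM oddb; case: (odd m).
  by rewrite mxtrace_specht_row // mulr1.
by rewrite mxtrace_specht_column // mul1r.
Qed.

(** The identity word weighs less than (d+1)^m, so lighter words use only the first m colours. There
    are at most m^m of them, each weight having at most m basis elements; the bound does not involve
    d. *)
Lemma card_lighter_identity (F : numFieldType) m d (m_gt1 : (1 < m)%N)
    (le_md : (m <= d)%N) :
  (#|lighter (@word_weight F m d)
      (weight d.+1 [ffun k : 'I_m => widen_ord le_md k])| <= m ^ m * m)%N.
Proof.
set v0 := weight _ _; pose g_word (g : {ffun 'I_m -> 'I_m}) : {ffun 'I_m -> 'I_d} :=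
  [ffun k => widen_ord le_md (g k)].
pose E g := level (@word_weight F m d) (weight d.+1 (g_word g)).
have v0_lt : (v0 < d.+1 ^ m)%N.
  have d_gt0 : (0 < d)%N := leq_trans (ltnW m_gt1) le_md.
  rewrite /v0 /weight (eq_bigr (fun k : 'I_m => d.+1 ^ k)%N) => [|k _]; last first.
    by rewrite ffunE.
  elim: (m) => [|k IHk]; first by rewrite big_ord0.
  rewrite big_ord_recr /= expnS mulSn addnC -addnS leq_add2l.
  by apply: leq_trans IHk _; rewrite leq_pmull.
have sub : lighter (@word_weight F m d) v0 \subset \bigcup_g E g.
  apply/subsetP => b; rewrite inE; have [c cE] := word_of_basis b.
  rewrite -cE => lt; have c_lt k : (c k < m)%N.
    rewrite -(ltn_exp2l (m := d.+1)) ?ltnS; last exact: leq_trans (ltnW m_gt1) le_md.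
    apply: leq_ltn_trans v0_lt; apply: leq_trans (ltnW lt).
    by rewrite /weight (bigD1 k) //= leq_addr.
  apply/bigcupP; exists [ffun k => Ordinal (c_lt k)] => //; rewrite inE -cE; apply/eqP.
  by congr weight; apply/ffunP => k; rewrite !ffunE; apply: val_inj.
apply: leq_trans (subset_leq_card sub) _.
apply: (@leq_trans (\sum_g #|E g|)%N).
  elim/big_rec2: _ => [|g k S _ le]; first by rewrite cards0.
  by apply: leq_trans (leq_card_setU _ _) _; rewrite leq_add2l.
apply: (@leq_trans (\sum_(g : {ffun 'I_m -> 'I_m}) m)%N).
  apply: leq_sum => g _.
  have [->|le1] := card_level_leq F m_gt1 le_md (weight d.+1 (g_word g)).
    exact: leq_pred.
  exact: leq_trans le1 (ltnW m_gt1).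
by rewrite sum_nat_const card_ffun !card_ord.
Qed.

Local Close Scope ring_scope.
Local Close Scope group_scope.

Theorem corollary9p8 (m : nat) (hm : 2 <= m) :
  let nu (n : nat) : seq nat := if odd m then [:: n] else nseq n 1 in
  let H (n : nat) : representation rat [set: 'S_(m * n)] :=
    foulkes rat m n [:: m.-1; 1] (nu n) in
  (forall n : nat, 0 < n ->
     exists2 la : seq nat, is_lex_min_constituent (H n) la &
     exists2 e : nat, 1 <= e <= m.-1 &
       has_multiplicity (specht rat (m * n) la) (H n) 'C(m.-1, e))
  /\
  (forall e : nat, 1 <= e <= m.-1 ->
     exists2 n : nat, 0 < n &
     exists2 la : seq nat, is_lex_min_constituent (H n) la &
       has_multiplicity (specht rat (m * n) la) (H n) 'C(m.-1, e)).
Proof.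
move=> nu H; split=> [n n_gt0|e /andP[e_gt0 le_e]].
  have le_md : (m <= m * n)%N by apply: leq_pmulr.
  have [v [e [en /andP[e_gt0 le_e]]]] :=
    threshold (@word_weight _ m (m * n)) n_gt0
      (card_word_basis rat hm le_md (leqnn _) n_gt0).
  have [|la la_min la_mult] := foulkes_lex_min hm (leqnn _)
    (fun s => foulkes_sign rat m s n_gt0) en; first by rewrite e_gt0 le_e.
  exists la => //; have [lev|lev] := card_level_leq rat hm le_md v.
    by rewrite lev in le_e la_mult; exists e; rewrite ?e_gt0.
  (* A level with at most one element forces e = 1, and binom(1,1) = 1 = binom(m-1,m-1). *)
  exists m.-1; first by rewrite leqnn andbT -ltnS prednK // ltnW.
  have e1 : e = 1%N by apply/eqP; rewrite eqn_leq e_gt0 (leq_trans le_e lev).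
  have lev1 : #|level (@word_weight rat m (m * n)) v| = 1%N.
    by apply/eqP; rewrite eqn_leq lev -e1 le_e.
  by rewrite lev1 e1 binn in la_mult; rewrite binn.
(* Here n will depend on d through the lighter elements. As these number at most m^m * m for every
   d, and e is at most m, this d satisfies m * n <= d. *)
pose d := (m * (m ^ m * m + m))%N.
have m_gt0 : (0 < m)%N := ltnW hm.
have le_md : (m <= d)%N by rewrite leq_pmulr // addn_gt0 m_gt0 orbT.
pose c : {ffun 'I_m -> 'I_d} := [ffun k => widen_ord le_md k].
have c_inj : injective c by move=> k l; rewrite !ffunE => /(congr1 val) /= /val_inj.
have lev := card_level_injective rat hm le_md c_inj.
pose n := (#|lighter (@word_weight rat m d) (weight d.+1 c)| + e)%N.
have n_gt0 : (0 < n)%N by rewrite addn_gt0 e_gt0 orbT.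
have le_mnd : (m * n <= d)%N.
  rewrite leq_pmul2l // leq_add ?card_lighter_identity //.
  exact: leq_trans le_e (leq_pred _).
exists n => //.
have [|la la_min la_mult] := foulkes_lex_min hm le_mnd
  (fun s => foulkes_sign rat m s n_gt0) (erefl n); first by rewrite e_gt0 lev.
by rewrite lev in la_mult; exists la.
Qed.
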